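(* Let $\Omega\subset\mathbb{R}^n$ be a bounded domain and $1<p<\infty$. Let $v$ be a weight on $\Omega$ with $v\in L^1(\Omega)$, let $Q$ be a measurable, symmetric, nonnegative definite $n\times n$ matrix function on $\Omega$ with $|Q(x)|_{\mathrm{op}}^{p/2}\le k\,v(x)$ for a.e. $x\in\Omega$ (some constant $k$), and let $\mathbf t\cdot\nabla$ be a degenerate subunit vector field on $\Omega$. Suppose that the Sobolev inequality with no gain $$\|\varphi\|_{L^N(v,\Omega)}\le S_N\|\nabla\varphi\|_{QL^p(\Omega)}\qquad\text{for all }\varphi\in \mathrm{Lip}_0(\Omega),\qquad N(t)=t^p,$$ holds. Let $f,g\in L^\infty(v,\Omega)$. Let $r>0$ and $H(t)=t^r\exp(t)$. Then there is a constant $C$, depending only on $H,\mathbf t,p,S_N,\Omega,v$ (and in particular independent of $u,f,g$), such that every degenerate weak subsolution $u\in QH^{1,p}_0(v,\Omega)$ of the Dirichlet problem (D) (see context) satisfies $$\|u^+\|_{L^H(v,\Omega)}\le C\big(\|f\|_{L^\infty(v,\Omega)}+\|g\|_{L^\infty(v,\Omega)}\big),$$ and every degenerate weak supersolution $u\in QH^{1,p}_0(v,\Omega)$ of (D) satisfies the same bound with $u^-$ in place of $u^+$. In particular, if $u$ is a degenerate weak solution of (D), then $u\in L^H(v,\Omega)$ with this bound (with a constant having the same dependence).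
   Context: A weight $v$ is a nonnegative measurable function; $v(E)=\int_E v\,dx$. $L^p(v,\Omega)$ is the Lebesgue space with respect to the measure $v\,dx$, and $\|\cdot\|_{L^\infty(v,\Omega)}$ is the essential supremum with respect to $v\,dx$. For an increasing function $\Phi:[0,\infty)\to[0,\infty)$ with $\Phi(0)=0$, $\|h\|_{L^\Phi(v,\Omega)}=\inf\{\lambda>0:\int_\Omega \Phi(|h|/\lambda)\,v\,dx\le 1\}$, and $L^\Phi(v,\Omega)$ is the set of measurable $h:\Omega\to\mathbb{R}$ for which this is finite. $\mathrm{Lip}_0(\Omega)$ is the set of locally Lipschitz functions with compact support in $\Omega$. $QL^p(\Omega)$ is the space of measurable $\mathbf g:\Omega\to\mathbb{R}^n$ with $\|\mathbf g\|_{QL^p(\Omega)}=(\int_\Omega|\sqrt{Q}\,\mathbf g|^p\,dx)^{1/p}<\infty$, with functions identified when their difference has norm $0$. $QH^{1,p}_0(v,\Omega)$ is the completion of $\mathrm{Lip}_0(\Omega)$ in the norm $\|\psi\|_{L^p(v,\Omega)}+\|\nabla\psi\|_{QL^p(\Omega)}$; its elements are identified with pairs $(u,\nabla u)\in L^p(v,\Omega)\times QL^p(\Omega)$ that are limits in $L^p(v,\Omega)\times QL^p(\Omega)$ of sequences $(\psi_j,\nabla\psi_j)$ with $\psi_j\in\mathrm{Lip}_0(\Omega)$. Here ''$\nabla u$'' is notation for the second component (it need not be a classical weak gradient), and one writes $u\in QH^{1,p}_0(v,\Omega)$ for the pair. For measurable $\mathbf t:\Omega\to\mathbb{R}^n$,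 $\mathbf t\cdot\nabla$ is a degenerate subunit vector field if there is a constant $C(\mathbf t)>0$ with $\|\mathbf t\cdot\nabla\varphi\|_{L^p(v,\Omega)}\le C(\mathbf t)\|\nabla\varphi\|_{QL^p(\Omega)}$ for every $\varphi\in\mathrm{Lip}_0(\Omega)$. Dependence of a constant on $\mathbf t$ includes dependence on $C(\mathbf t)$. The Dirichlet problem (D) is, formally, $$-v^{-1}\mathrm{div}(|\sqrt Q\nabla u|^{p-2}Q\nabla u)=f|f|^{p-2}-v^{-1}\mathrm{div}(v|g|^{p-2}g\,\mathbf t)\ \text{in }\Omega,\qquad u=0\text{ on }\partial\Omega,$$ with $f,g$ real-valued measurable functions. A pair $(u,\nabla u)\in QH^{1,p}_0(v,\Omega)$ is a degenerate weak solution of (D) if $$\int_\Omega|\sqrt Q\nabla u|^{p-2}\,\nabla\varphi\cdot Q\nabla u\,dx=\int_\Omega\big(f|f|^{p-2}\varphi+|g|^{p-2}g\,\mathbf t\cdot\nabla\varphi\big)\,v\,dx$$ for every $\varphi\in\mathrm{Lip}_0(\Omega)$. It is a degenerate weak subsolution (supersolution) if this holds with ''$=$'' replaced by ''$\le$'' (''$\ge$'') for every nonnegative $\varphi\in\mathrm{Lip}_0(\Omega)$. Expressions $|w|^{p-2}w$ are $0$ where $w=0$. Finally $u^+=\max(u,0)$, $u^-=\max(-u,0)$. *)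

(* Defs.v *)
From HB Require Import structures.
From mathcomp Require Import all_boot all_order all_algebra.
From mathcomp Require Import all_classical all_reals all_analysis.

Set Implicit Arguments.
Unset Strict Implicit.
Unset Printing Implicit Defensive.

Import Order.TTheory GRing.Theory Num.Theory.
Import numFieldNormedType.Exports.

Local Open Scope classical_set_scope.
Local Open Scope ring_scope.

(* Lebesgue measure on R^n (written n.+1 below, so that n >= 1): the
   Caratheodory measure of the outer measure given by countable covers by
   half-open boxes. The sigma-algebra is that of all Lebesgue measurable sets,
   so the measure is complete. *)

Section lebesgue_outer.
Context (R : realType) (n : nat).
Local Notation point := 'rV[R]_n.+1.

Definition box (I : point * point) : set point :=
  [set x | forall i, I.1 ord0 i < x ord0 i <= I.2 ord0 i].

Definition box_vol (I : point * point) : R :=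
  \prod_(i < n.+1) Num.max 0 (I.2 ord0 i - I.1 ord0 i).

Definition box_cover (X : set point) : set ((point * point)^nat) :=
  [set I | X `<=` \bigcup_k box (I k)].

Local Open Scope ereal_scope.

Definition lebesgue_outer (X : set point) : \bar R :=
  ereal_inf [set \sum_(k <oo) (box_vol (I k))%:E | I in box_cover X].

Let vol_ge0 I : 0 <= (box_vol I)%:E.
Proof. by rewrite lee_fin; apply: prodr_ge0 => i _; rewrite le_max lexx. Qed.

Let vol0 : (box_vol (0, 0)%R)%:E = 0.
Proof.
by congr EFin; rewrite /box_vol big_ord_recl /= subrr maxxx mul0r.
Qed.

Let outer_ge0 X : 0 <= lebesgue_outer X.
Proof.
apply: le_ereal_inf_tmp => x [I _ <-{x}].
by apply: nneseries_ge0 => k _ _; exact: vol_ge0.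
Qed.

Let outer0 : lebesgue_outer set0 = 0.
Proof.
apply/eqP; rewrite eq_le outer_ge0 andbT.
apply: ereal_inf_lbound; exists (fun=> (0, 0)%R); first by move=> x [].
by apply: eseries0 => k _ _; exact: vol0.
Qed.

Let le_outer : {homo lebesgue_outer : A B / A `<=` B >-> A <= B}.
Proof.
move=> A B AB; apply: ereal_inf_le_tmp => x [I BI <-{x}].
by exists I => //; exact: subset_trans BI.
Qed.

Let outer_sigma_subadditive : sigma_subadditive lebesgue_outer.
Proof.
move=> A; have [[i ioo]|] := pselect (exists i, lebesgue_outer (A i) = +oo).
  rewrite (eseries_pinfty _ _ ioo) ?leey// => k _.
  by rewrite -ltNye (lt_le_trans _ (outer_ge0 _)).
rewrite -forallNE => Aoo.
suff add2e (e : {posnum R}) : lebesgue_outer (\bigcup_k A k) <=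
    \sum_(i <oo) lebesgue_outer (A i) + e%:num%:E.
  by apply/lee_addgt0Pr => _/posnumP[].
apply: le_trans (epsilon_trick xpredT _ _) => //.
pose P k (B : (point * point)^nat) := box_cover (A k) B /\
  \sum_(j <oo) (box_vol (B j))%:E <=
    lebesgue_outer (A k) + (e%:num / (2 ^ k.+1)%:R)%:E.
have [G PG] : {G : ((point * point)^nat)^nat & forall k, P k (G k)}.
  apply: (@choice _ _ P) => k; rewrite /P.
  have fAk : lebesgue_outer (A k) \is a fin_num.
    by rewrite ge0_fin_numE ?outer_ge0// ltey; apply/eqP/Aoo.
  have ek1 : (0 < e%:num / (2 ^ k.+1)%:R :> R)%R by [].
  have [x [B AB <-] xS] := lb_ereal_inf_adherent ek1 fAk.
  by exists B; split => //; exact/ltW.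
pose w (u : nat * nat) := (box_vol (G u.1 u.2))%:E.
apply: (@le_trans _ _ (\esum_(i in setT) w i)).
  apply: ereal_inf_lbound => /=.
  have /card_esym/ppcard_eqP[f] := card_nat2.
  exists (fun k => G (f k).1 (f k).2).
    move=> t [i _] /(proj1 (PG i))[j _ Bijt].
    by exists (f^-1%FUN (i, j)) => //=; rewrite invK ?inE.
  rewrite -(esum_pred_image w _ xpredT) ?[fun=> _]set_true//.
    by rewrite image_eq.
  by move=> *; exact: vol_ge0.
rewrite (_ : esum _ _ = \sum_(i <oo) \sum_(j <oo) (box_vol (G i j))%:E);
    last first.
  pose J : nat -> set (nat * nat) := fun i => [set (i, j) | j in setT].
  rewrite (_ : setT = \bigcup_k J k); last first.
    by rewrite predeqE => -[a b]; split => // _; exists a => //; exists b.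
  rewrite esum_bigcupT /=; last 2 first.
    - apply/trivIsetP => i j _ _ ij.
      rewrite predeqE => -[k m] /=; split => //= -[] [_] _ [<-{k} _].
      by move=> [m' _] [] /esym/eqP; rewrite (negbTE ij).
    - by move=> [k m]; exact: vol_ge0.
  rewrite -(image_id [set: nat]) -fun_true esum_pred_image//; last first.
    by move=> k _; apply: esum_ge0 => *; exact: vol_ge0.
  apply: eq_eseriesr => /= j _.
  rewrite -(esum_pred_image w (pair j) predT)//=; last 2 first.
    by move=> *; exact: vol_ge0.
    by move=> ? ? _ _; exact: (@can_inj _ _ _ snd).
  by congr esum; rewrite predeqE => -[a b]; split; move=> [i _ <-]; exists i.
apply: lee_nneseries => [i _ _|i _].
  by apply: nneseries_ge0 => *; exact: vol_ge0.
by have [] := PG i.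
Qed.

HB.instance Definition _ := isOuterMeasure.Build R point lebesgue_outer
  outer0 outer_ge0 le_outer outer_sigma_subadditive.

End lebesgue_outer.

Definition lebesgue_outer_measure (R : realType) (n : nat) :
  {outer_measure set 'rV[R]_n.+1 -> \bar R} := @lebesgue_outer R n.

(* R^n with its Lebesgue measurable sets; convertible to 'rV[R]_n.+1 *)
Notation lebRn R n := (caratheodory_type (@lebesgue_outer_measure R n)).

Definition lebesgue (R : realType) (n : nat) :
  {measure set (lebRn R n) -> \bar R} := @lebesgue_outer_measure R n.

Arguments lebesgue {R n}.

Section matrices.
Context (R : realType) (n : nat).
Implicit Types (A : 'M[R]_n.+1) (x y : 'cV[R]_n.+1).

Definition dot x y : R := \sum_i x i ord0 * y i ord0.

(* Euclidean norm; the norm `|x| of the library is the sup norm *)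
Definition enorm x : R := Num.sqrt (dot x x).

Definition opnorm A : R :=
  sup [set enorm (A *m x) | x in [set x | enorm x <= 1]].

Definition psdmx A := A^T = A /\ forall x, 0 <= dot x (A *m x).

(* the unique nonnegative definite square root of a nonnegative definite A *)
Definition sqrtmx A : 'M[R]_n.+1 :=
  xget 0 [set B : 'M[R]_n.+1 | psdmx B /\ B *m B = A].

End matrices.

Section weighted_spaces.
Context (R : realType) (n : nat).
Local Notation point := 'rV[R]_n.+1.
Local Notation vec := 'cV[R]_n.+1.
Implicit Types (Omega : set point) (v h f phi : point -> R).
Implicit Types (G t : point -> vec) (Q : point -> 'M[R]_n.+1) (p : R).

Definition bounded_domain Omega :=
  [/\ open Omega, connected Omega, Omega !=set0 & bounded_set Omega].

Definition lebesgue_measurable Omega h :=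
  measurable_fun (Omega : set (lebRn R n)) (h : lebRn R n -> R).

Definition vec_measurable Omega G :=
  forall i, lebesgue_measurable Omega (fun x => G x i ord0).

Definition mx_measurable Omega Q :=
  forall i j, lebesgue_measurable Omega (fun x => Q x i j).

Definition weight Omega v :=
  lebesgue_measurable Omega v /\ forall x, Omega x -> 0 <= v x.

Definition L1 Omega v : Prop :=
  lebesgue.-integrable (Omega : set (lebRn R n)) (EFin \o v).

Definition weighted_measure v (E : set point) : \bar R :=
  (\int[lebesgue]_(x in (E : set (lebRn R n))) (v x)%:E)%E.

Definition Lp_norm p v Omega h : \bar R :=
  ((\int[lebesgue]_(x in (Omega : set (lebRn R n)))
      (`|h x| `^ p * v x)%:E) `^ p^-1)%E.

Definition Lp p v Omega h :=
  lebesgue_measurable Omega h /\ (Lp_norm p v Omega h < +oo)%E.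

Definition Linfty_norm v Omega h : \bar R :=
  ereal_inf [set M%:E | M in [set M : R | 0 <= M /\
    weighted_measure v (Omega `&` [set x | M < `|h x|]) = 0%E]].

Definition Linfty v Omega h :=
  lebesgue_measurable Omega h /\ (Linfty_norm v Omega h < +oo)%E.

Definition Orlicz_norm (Phi : R -> R) v Omega h : \bar R :=
  ereal_inf [set l%:E | l in [set l : R | 0 < l /\
    (\int[lebesgue]_(x in (Omega : set (lebRn R n)))
       (Phi (`|h x| / l) * v x)%:E <= 1)%E]].

Definition Orlicz (Phi : R -> R) v Omega h :=
  lebesgue_measurable Omega h /\ (Orlicz_norm Phi v Omega h < +oo)%E.

Definition QLp_norm p Q Omega G : \bar R :=
  ((\int[lebesgue]_(x in (Omega : set (lebRn R n)))
      (enorm (sqrtmx (Q x) *m G x) `^ p)%:E) `^ p^-1)%E.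

Definition QLp p Q Omega G :=
  vec_measurable Omega G /\ (QLp_norm p Q Omega G < +oo)%E.

(* Elements of Lip_0(Omega) are represented by their extension by 0 to R^n. *)
Definition Lip0 Omega phi :=
  [/\ forall x, Omega x ->
        exists2 U, nbhs x U & [lipschitz phi y | y in U],
      compact (closure [set x | phi x != 0]) &
      closure [set x | phi x != 0] `<=` Omega].

(* 'D is total; by Rademacher's theorem its value is meaningful almost
   everywhere when phi is locally Lipschitz. *)
Definition grad phi : point -> vec :=
  fun x => \col_i 'D_(delta_mx ord0 i) phi x.

Definition QH0 p v Q Omega (u : point -> R) (gradu : point -> vec) :=
  [/\ Lp p v Omega u, QLp p Q Omega gradu &
      exists psi : (point -> R)^nat,
      [/\ forall j, Lip0 Omega (psi j),
          Lp_norm p v Omega (fun x => u x - psi j x) @[j --> \oo] --> 0%E &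
          QLp_norm p Q Omega (fun x => gradu x - grad (psi j) x)
            @[j --> \oo] --> 0%E]].

Definition subunit p v Q Omega t (Ct : R) :=
  forall phi, Lip0 Omega phi ->
    (Lp_norm p v Omega (fun x => dot (t x) (grad phi x)) <=
     Ct%:E * QLp_norm p Q Omega (grad phi))%E.

Definition sobolev_no_gain p v Q Omega (SN : R) :=
  forall phi, Lip0 Omega phi ->
    (Orlicz_norm (fun s : R => s `^ p)%R v Omega phi <=
     SN%:E * QLp_norm p Q Omega (grad phi))%E.

(* The two sides of the weak formulation of
     -v^-1 div(|sqrt(Q) grad u|^(p-2) Q grad u)
       = f |f|^(p-2) - v^-1 div(v |g|^(p-2) g t).
   As b `^ (p - 2) is finite for b = 0, both |w|^(p-2) w and
   |sqrt(Q) grad u|^(p-2) Q grad u are 0 where w, resp. sqrt(Q) grad u, is. *)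
Definition dirichlet_lhs p Q Omega (gradu : point -> vec) phi : \bar R :=
  (\int[lebesgue]_(x in (Omega : set (lebRn R n)))
     (enorm (sqrtmx (Q x) *m gradu x) `^ (p - 2) *
      dot (grad phi x) (Q x *m gradu x))%:E)%E.

Definition dirichlet_rhs p v Omega t f (g : point -> R) phi : \bar R :=
  (\int[lebesgue]_(x in (Omega : set (lebRn R n)))
     ((f x * `|f x| `^ (p - 2) * phi x +
       `|g x| `^ (p - 2) * g x * dot (t x) (grad phi x)) * v x)%:E)%E.

Definition weak_subsolution p v Q Omega t f (g : point -> R) u gradu :=
  QH0 p v Q Omega u gradu /\
  forall phi, Lip0 Omega phi -> (forall x, 0 <= phi x) ->
    (dirichlet_lhs p Q Omega gradu phi <= dirichlet_rhs p v Omega t f g phi)%E.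

Definition weak_supersolution p v Q Omega t f (g : point -> R) u gradu :=
  QH0 p v Q Omega u gradu /\
  forall phi, Lip0 Omega phi -> (forall x, 0 <= phi x) ->
    (dirichlet_lhs p Q Omega gradu phi >= dirichlet_rhs p v Omega t f g phi)%E.

Definition weak_solution p v Q Omega t f (g : point -> R) u gradu :=
  QH0 p v Q Omega u gradu /\
  forall phi, Lip0 Omega phi ->
    dirichlet_lhs p Q Omega gradu phi = dirichlet_rhs p v Omega t f g phi.

End weighted_spaces.

(* Main.v *)
Require Import Defs.
From mathcomp Require Import all_boot all_order all_algebra.
From mathcomp Require Import all_classical all_reals all_analysis.
From mathcomp Require Import measurable_realfun.
From mathcomp Require Import complex ring lra.

(* After dividing u by M > |f|_oo + |g|_oo one may take |f|, |g| <= 1. Choose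
   psi in Lip_0 close to u and test the weak inequality with G(psi), where
   h(s) = exp(gamma s) - 1 for s >= 0, frozen at a large level L, G' = h^p and
   K' = h. With a Young-type splitting of h(psi)^p |t . grad psi|, the subunit
   and Sobolev inequalities for K(psi) bound everything by the energy
   X = int h(psi)^p |sqrt(Q) grad psi|^p. Since
   h <= 2 gamma K + 1 and G <= K h^(p-1), both G and h^p are at most
   eta K^p + C with eta small when gamma is small; this is where p > 1 enters.
   Hence X is absorbed, int K(u)^p v is bounded independently of L, and letting
   L go to infinity exp(p gamma u^+) is integrable with respect to v dx, which
   gives the Orlicz bound.

   No almost everywhere differentiability is used: for psi locally Lipschitz
   the chain rule grad (G o psi) = G'(psi) grad psi holds at every point for
   the total operator 'D, and only the single function psi is ever
   approximated, so that grad need not be additive. *)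

Set Implicit Arguments.
Unset Strict Implicit.
Unset Printing Implicit Defensive.

Import Order.TTheory GRing.Theory Num.Theory.
Import numFieldNormedType.Exports.

Local Open Scope classical_set_scope.
Local Open Scope ring_scope.

(** * Square roots of nonnegative definite matrices *)

(** With no gain in the Sobolev inequality there is no better exponent to iterate on, so an
    exponential is tested at once. The choice K' = h, G' = h^p makes the energy of K(psi) equal to
    the quantity X that the left side of the weak inequality produces for the test function G(psi),
    so the hypotheses on K(psi) speak about X itself. The obstacle is that u is only a limit: gradu
    need not be its gradient, and G(u) is not a test function. Hence the left side pairs gradu with
    grad psi, and the mismatch costs sup h^p times the energy of gradu - grad psi. Freezing h makes
    this supremum finite and X finite, so that X can be absorbed; psi is then chosen in terms of the
    supremum, and the cost is at most 1. The order of choices gives the uniformity: eta depends on p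
    and on the subunit and Sobolev constants, gamma and C on p and eta, the bound X0 on these and on
    the integral of v. All precede Q, u, f, g and L. Supersolutions are treated together with
    subsolutions by multiplying u by a sign. *)

Section sqrt_matrix.
Context (R : realType) (n : nat).
Implicit Types A : 'M[R]_n.+1.

(** Newton's scheme: a multiple of the product of the [X - b] over the old nodes corrects the value
    at the new node and leaves the old values alone. *)
Lemma poly_interpolation (F : fieldType) (f : F -> F) (s : seq F) :
  exists P : {poly F}, {in s, forall a, P.[a] = f a}.
Proof.
elim: s => [|a s [P Pf]]; first by exists 0.
have [as_|as_] := boolP (a \in s).
  by exists P => b; rewrite inE => /predU1P[->|]; exact: Pf.
pose N : {poly F} := \prod_(b <- s) ('X - b%:P).
have Na : N.[a] != 0 by rewrite -rootE root_prod_XsubC.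
exists (P + ((f a - P.[a]) / N.[a])%:P * N) => b; rewrite !hornerE inE.
move=> /predU1P[->|bs]; first by rewrite divfK// addrC subrK.
have /eqP -> : N.[b] == 0 by rewrite -rootE root_prod_XsubC.
by rewrite mulr0 addr0 Pf.
Qed.

Lemma horner_mx_conj_diag (F : fieldType) (P : 'M[F]_n.+1) d (q : {poly F}) :
  P \is a GRing.unit -> horner_mx (invmx P *m diag_mx d *m P) q =
  invmx P *m diag_mx (map_mx (horner q) d) *m P.
Proof. by move=> Pu; rewrite horner_mx_uconjC// horner_mx_diag. Qed.

Lemma mulmx_conj_diag (F : fieldType) (P : 'M[F]_n.+1) d1 d2 :
  P \is a GRing.unit ->
  (invmx P *m diag_mx d1 *m P) *m (invmx P *m diag_mx d2 *m P) =
  invmx P *m diag_mx (\row_j (d1 ord0 j * d2 ord0 j)) *m P.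
Proof.
move=> Pu; rewrite -!mulmxA (mulmxA P (invmx P)) mulmxV// mul1mx.
by rewrite (mulmxA (diag_mx d1)) mulmx_diag.
Qed.

Lemma dot_mx (x y : 'cV[R]_n.+1) : dot x y = (x^T *m y) ord0 ord0.
Proof. by rewrite mxE; apply: eq_bigr => i _; rewrite mxE. Qed.

Lemma dot_trmx A (x y : 'cV[R]_n.+1) : dot x (A *m y) = dot (A^T *m x) y.
Proof. by rewrite !dot_mx trmx_mul trmxK mulmxA. Qed.

Lemma dot_ge0 (x : 'cV[R]_n.+1) : 0 <= dot x x.
Proof. by apply: sumr_ge0 => i _; rewrite -expr2 sqr_ge0. Qed.

Lemma dot_eq0 (x : 'cV[R]_n.+1) : dot x x = 0 -> x = 0.
Proof.
move/eqP; rewrite /dot psumr_eq0; last by move=> i _; rewrite -expr2 sqr_ge0.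
move=> /allP x0; apply/matrixP => i j; rewrite (ord1 j) mxE.
by have := x0 i; rewrite mem_index_enum => /(_ isT); rewrite mulf_eq0 orbb => /eqP.
Qed.

Lemma psdmx_eigenvalue_ge0 A a : psdmx A -> eigenvalue A a -> 0 <= a.
Proof.
move=> [AT A0] /eigenvalueP[w wA w0].
have := A0 w^T; rewrite -{1}AT -trmx_mul wA linearZ /=.
have -> : dot w^T (a *: w^T) = a * dot w^T w^T.
  by rewrite /dot mulr_sumr; apply: eq_bigr => i _; rewrite !mxE mulrCA.
apply: contraTT; rewrite -!ltNge => a0.
rewrite pmulr_llt0// lt_neqAle dot_ge0 andbT eq_sym.
apply: contraNneq w0 => /dot_eq0 /(congr1 trmx).
by rewrite trmxK trmx0 => ->.
Qed.

(* A polynomial in A taking the value a^(1/4) at each eigenvalue a is a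
   symmetric fourth root of A; its square is then nonnegative definite. *)
Lemma psdmx_sqrt_complex (C : numClosedFieldType) (c : {rmorphism R -> C}) A :
  (forall z, reflect (exists x, z = c x) (z \is Num.real)) -> psdmx A ->
  exists B : 'M[R]_n.+1, psdmx B /\ B *m B = A.
Proof.
move=> cP psdA; have [AT A0] := psdA.
pose AC := map_mx c A.
have ACsym : AC \is symmetricmx.
  by rewrite is_hermitianmxE expr0 scale1r map_mx_id// /AC map_trmx AT.
have ACreal : AC \is a mxOver Num.real.
  by apply/mxOverP => i j; rewrite mxE; apply/cP; exists (A i j).
have ACherm := realsym_hermsym ACsym ACreal.
have /orthomx_spectralP := hermitian_normalmx ACherm.
set P := spectralmx AC; set d := spectral_diag AC => ACE.
have Pu : P \is a GRing.unit by exact: spectral_unit.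
have /choice[l dl] : forall i, exists x, d ord0 i = c x.
  move=> i; apply/cP.
  by have /mxOverP/(_ ord0 i) := hermitian_spectral_diag_real ACherm.
(* The characteristic polynomial of the complexified matrix is the image of that of [A], so the real
   number [l i] is an eigenvalue of [A] itself. *)
have l0 i : 0 <= l i.
  apply: (psdmx_eigenvalue_ge0 psdA); rewrite eigenvalue_root_char.
  rewrite -(fmorph_root c) map_char_poly -eigenvalue_root_char -/AC -dl.
  apply/eigenvalueP; exists (row i P).
    rewrite {1}ACE -row_mul !mulmxA mulmxV// mul1mx row_mul.
    by rewrite row_diag_mx -scalemxAl -rowE.
  apply/eqP => /(congr1 (fun w => w *m invmx P)); rewrite -row_mul mulmxV// mul0mx.
  by move=> /matrixP/(_ ord0 i); rewrite !mxE eqxx => /eqP; rewrite oner_eq0.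
have [q qE] := poly_interpolation (fun a : R => Num.sqrt (Num.sqrt a))
  [seq l i | i <- enum 'I_n.+1].
pose S := horner_mx A q.
have ST : S^T = S.
  rewrite /S; elim/poly_ind: q {qE S} => [|q a IH]; first by rewrite rmorph0 trmx0.
  rewrite rmorphD rmorphM /= horner_mx_X horner_mx_C linearD /= trmx_mul IH AT.
  rewrite tr_scalar_mx; congr (_ + _); apply: comm_mx_horner.
  exact: comm_mx_refl.
have SC : map_mx c S = invmx P *m diag_mx (map_mx (horner (map_poly c q)) d) *m P.
  rewrite map_horner_mx -/AC [in LHS]ACE.
  exact: horner_mx_conj_diag.
have S4 : S *m S *m (S *m S) = A.
  apply: (map_mx_inj (f := c)); rewrite -/AC ACE !map_mxM SC.
  rewrite !mulmx_conj_diag//; congr (_ *m _ *m _).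
  congr diag_mx; apply/rowP => i; rewrite !mxE dl.
  rewrite horner_map qE ?map_f ?mem_enum// -!rmorphM /=.
  by congr (c _); rewrite -!expr2 !sqr_sqrtr ?sqrtr_ge0.
exists (S *m S); split=> //; split.
  by rewrite trmx_mul ST.
by move=> x; rewrite -mulmxA dot_trmx ST dot_ge0.
Qed.

(** [sqrtmx] selects a root by choice, with a default value when there is none, so its properties
    come from the existence of one root. *)
Lemma psdmx_sqrtmx A : psdmx A ->
  psdmx (sqrtmx A) /\ sqrtmx A *m sqrtmx A = A.
Proof.
move=> /(psdmx_sqrt_complex (c := @real_complex R) (@complex_realP R))/cid[B BA].
by rewrite /sqrtmx; case: xgetP => [D _ //|/(_ B)/(_ BA)].
Qed.

End sqrt_matrix.

(** * Inner product, Euclidean norm, and the length of sqrt(Q) x *)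

Section euclidean.
Context (R : realType) (n : nat).
Implicit Types (x y z : 'cV[R]_n.+1) (Q : 'M[R]_n.+1).

Lemma dotC x y : dot x y = dot y x.
Proof. by apply: eq_bigr => i _; rewrite mulrC. Qed.

Lemma dotZl (c : R) x y : dot (c *: x) y = c * dot x y.
Proof. by rewrite /dot mulr_sumr; apply: eq_bigr => i _; rewrite !mxE mulrA. Qed.

Lemma dotZr (c : R) x y : dot x (c *: y) = c * dot x y.
Proof. by rewrite dotC dotZl dotC. Qed.

Lemma dotBl x y z : dot (x - y) z = dot x z - dot y z.
Proof. by rewrite /dot -sumrB; apply: eq_bigr => i _; rewrite !mxE mulrBl. Qed.

Lemma dotBr x y z : dot x (y - z) = dot x y - dot x z.
Proof. by rewrite dotC dotBl !(dotC x). Qed.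

Lemma enorm_ge0 x : 0 <= enorm x.
Proof. exact: sqrtr_ge0. Qed.

Lemma enorm_sqr x : enorm x * enorm x = dot x x.
Proof. by rewrite -expr2 sqr_sqrtr// dot_ge0. Qed.

Lemma enormZ (c : R) x : enorm (c *: x) = `|c| * enorm x.
Proof. by rewrite /enorm dotZl dotZr mulrA -expr2 sqrtrM ?sqr_ge0// sqrtr_sqr. Qed.

Lemma cauchy_schwarz x y : `|dot x y| <= enorm x * enorm y.
Proof.
have [/dot_eq0 ->|y0] := eqVneq (dot y y) 0.
  by rewrite -(scale0r y) dotZr mul0r normr0 mulr_ge0 ?enorm_ge0//.
have yy : 0 < dot y y by rewrite lt_neqAle dot_ge0 eq_sym y0.
have := dot_ge0 (dot y y *: x - dot x y *: y).
rewrite !(dotBl, dotBr, dotZl, dotZr) (dotC y x) => H.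
have {H} : 0 <= dot y y * (dot x x * dot y y - dot x y * dot x y).
  by apply: le_trans H _; rewrite le_eqVlt; apply/orP; left; apply/eqP; ring.
rewrite pmulr_rge0// subr_ge0 => H.
rewrite -ler_sqr ?nnegrE ?mulr_ge0 ?enorm_ge0//.
by rewrite -normrX ger0_norm ?sqr_ge0// exprMn !expr2 !enorm_sqr.
Qed.

Lemma enorm_triangle x y : enorm x <= enorm y + enorm (y - x).
Proof.
rewrite -ler_sqr ?nnegrE ?addr_ge0 ?enorm_ge0//.
rewrite sqrrD !expr2 !enorm_sqr.
have := cauchy_schwarz y (y - x); rewrite ler_norml => /andP[+ _].
rewrite dotBl !dotBr (dotC x y) mulr2n; lra.
Qed.

Lemma dot_sqrtmx Q x y : psdmx Q ->
  dot x (Q *m y) = dot (sqrtmx Q *m x) (sqrtmx Q *m y).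
Proof.
move=> /psdmx_sqrtmx[[ST _] SS].
by rewrite -{1}SS -mulmxA dot_trmx ST.
Qed.

(** The root is chosen separately for each matrix, so nothing is known about how its entries depend
    on a point. The right side is the root of a polynomial in the entries of [Q] and [x]; this is
    how measurability of the length is obtained. *)
Lemma enorm_sqrtmx Q x : psdmx Q ->
  enorm (sqrtmx Q *m x) = Num.sqrt (dot x (Q *m x)).
Proof. by move=> psdQ; rewrite dot_sqrtmx. Qed.

End euclidean.

(** * Lebesgue measurable sets and functions *)

Section lebesgue_measurable_sets.
Context (R : realType) (n : nat).
Local Notation point := 'rV[R]_n.+1.

(* Cutting a box by the hyperplane x_i = a preserves the total volume. *)
Lemma measurable_halfspace (i : 'I_n.+1) (a : R) :
  measurable ([set x : point | x ord0 i <= a] : set (lebRn R n)).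
Proof.
apply: le_caratheodory_measurable => X; set A := [set x | _].
apply: le_ereal_inf_tmp => _ [I XI <-].
pose lo (J : point * point) : point * point :=
  (J.1, \row_j if j == i then Num.min (J.2 ord0 j) a else J.2 ord0 j).
pose hi (J : point * point) : point * point :=
  (\row_j if j == i then Num.max (J.1 ord0 j) a else J.1 ord0 j, J.2).
have volD (J : point * point) : box_vol J =
    Num.max 0 (J.2 ord0 i - J.1 ord0 i) *
    \prod_(j < n.+1 | j != i) Num.max 0 (J.2 ord0 j - J.1 ord0 j).
  by rewrite /box_vol (bigD1 i).
have volE J : box_vol J = box_vol (lo J) + box_vol (hi J).
  rewrite !volD !mxE eqxx.
  rewrite [X in _ = _ + _ * X](_ : _ = \prod_(j < n.+1 | j != i)
    Num.max 0 (J.2 ord0 j - J.1 ord0 j)); last first.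
    by apply: eq_bigr => j /negbTE ji; rewrite !mxE ji.
  rewrite [X in _ = _ * X + _](_ : _ = \prod_(j < n.+1 | j != i)
    Num.max 0 (J.2 ord0 j - J.1 ord0 j)); last first.
    by apply: eq_bigr => j /negbTE ji; rewrite !mxE ji.
  rewrite -mulrDl; congr (_ * _).
  by rewrite /Num.max /Num.min; do !case: ifPn; rewrite -?leNgt; lra.
have vol_ge0 J : (0 <= (box_vol J)%:E)%E.
  by rewrite lee_fin; apply: prodr_ge0 => j _; rewrite le_max lexx.
rewrite (eq_eseriesr (g := fun k =>
  ((box_vol (lo (I k)))%:E + (box_vol (hi (I k)))%:E)%E)); last first.
  by move=> k _; rewrite volE EFinD.
rewrite nneseriesD//; apply: leeD.
  apply: ereal_inf_lbound; exists (lo \o I) => // x [/XI[k _ Ix] xa].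
  exists k => // j; have := Ix j; rewrite !mxE; case: eqP => // -> /andP[xl xu].
  by rewrite xl le_min xu.
apply: ereal_inf_lbound; exists (hi \o I) => // x [/XI[k _ Ix] /negP xa].
exists k => // j; have := Ix j; rewrite !mxE; case: eqP => // -> /andP[xl xu].
by rewrite xu andbT gt_max xl ltNge xa.
Qed.

Lemma measurable_box (J : point * point) :
  measurable (box J : set (lebRn R n)).
Proof.
have -> : box J = \bigcap_(i in [set: 'I_n.+1])
    ([set x : point | x ord0 i <= J.2 ord0 i] `&`
     ~` [set x : point | x ord0 i <= J.1 ord0 i]).
  apply/seteqP; split => [x Jx i _|x Jx i].
    by have /andP[xl xu] := Jx i; split=> //; apply/negP; rewrite -ltNge.
  by have [xu /negP] := Jx i I; rewrite -ltNge => ->.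
apply: fin_bigcap_measurable => [|i _]; first exact: finite_finset.
apply: measurableI; first exact: measurable_halfspace.
by apply: measurableC; exact: measurable_halfspace.
Qed.

(** An open set is the union of the half-open boxes with rational corners that it contains, and
    these are countably many. *)
Lemma open_lebesgue_measurable (U : set point) :
  open U -> measurable (U : set (lebRn R n)).
Proof.
move=> oU; pose toR (q : 'rV[rat]_n.+1) : point := map_mx ratr q.
pose F (q : 'rV[rat]_n.+1 * 'rV[rat]_n.+1) : set point :=
  if `[< box (toR q.1, toR q.2) `<=` U >] then box (toR q.1, toR q.2) else set0.
have -> : U = \bigcup_q F q.
  apply/seteqP; split => [x Ux|x [q _]]; last first.
    by rewrite /F; case: asboolP => [qU /qU|].
  have /nbhs_ballP[e /= e0 xe] := open_nbhs_nbhs (conj oU Ux).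
  have [l lP] : exists l : 'rV[rat]_n.+1, forall i,
      x ord0 i - e < ratr (l ord0 i) < x ord0 i.
    have /choice[l lP] : forall i, exists q : rat, x ord0 i - e < ratr q < x ord0 i.
      move=> i; have [|q qP] := @rat_in_itvoo R (x ord0 i - e) (x ord0 i).
        by rewrite ltrBlDr ltrDl.
      by exists q; rewrite in_itv in qP.
    by exists (\row_i l i) => i; rewrite mxE.
  have [u uP] : exists u : 'rV[rat]_n.+1, forall i,
      x ord0 i < ratr (u ord0 i) < x ord0 i + e.
    have /choice[u uP] : forall i, exists q : rat, x ord0 i < ratr q < x ord0 i + e.
      move=> i; have [|q qP] := @rat_in_itvoo R (x ord0 i) (x ord0 i + e).
        by rewrite ltrDl.
      by exists q; rewrite in_itv in qP.
    by exists (\row_i u i) => i; rewrite mxE.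
  exists (l, u) => //; rewrite /F; case: asboolP => [_|[]] /=.
    by move=> i; rewrite !mxE; have /andP[_ ->] := lP i; have /andP[/ltW -> _] := uP i.
  move=> y yb; apply: xe; split=> // j i; rewrite (ord1 j) /ball /= ltr_norml.
  have := yb i; rewrite !mxE; have := lP i; have := uP i.
  by move=> /andP[? ?] /andP[? ?] /andP[? ?]; apply/andP; split; lra.
apply: countable_bigcupT_measurable => [|q]; first exact: countableP.
by rewrite /F; case: asboolP => _ //; exact: measurable_box.
Qed.

Lemma continuous_lebesgue_measurable (Omega : set point) (f : point -> R) :
  open Omega -> {in Omega, continuous f} -> lebesgue_measurable Omega f.
Proof.
move=> oO cf; apply: (measurability _ (RGenOpens.measurableE R)).
move=> _ [_ [a [b ->] <-]].
apply: open_lebesgue_measurable; rewrite openE => x [Ox fx].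
apply: filterI; first exact: open_nbhs_nbhs.
apply: (cf x); first exact: mem_set.
by apply: open_nbhs_nbhs; split => //; exact: interval_open.
Qed.

End lebesgue_measurable_sets.

(** * Chain rule and measurability of gradients *)

Section chain_rule.
Context (R : realType) (V : normedModType R).
Implicit Types (f : V -> R) (x e : V).

(** A bound against the single base point [x], not between pairs of nearby points: it controls the
    difference quotients at [x]. *)
Definition lipschitz_at f x :=
  exists k : R, \forall y \near x, `|f y - f x| <= k * `|y - x|.

Lemma lipschitz_at_continuous f x : lipschitz_at f x -> {for x, continuous f}.
Proof.
move=> [k fk]; apply/cvgrPdist_le => e e0 /=.
pose K := Num.max k 1.
have K0 : 0 < K by rewrite lt_max ltr01 orbT.
near=> y.
rewrite distrC (@le_trans _ _ (k * `|y - x|))//; first by near: y.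
rewrite (@le_trans _ _ (K * `|y - x|))//.
  by rewrite ler_wpM2r// le_max lexx.
rewrite mulrC -ler_pdivlMr// distrC.
apply/ltW; have : ball x (e / K) y by near: y; apply: nbhsx_ballx; exact: divr_gt0.
by rewrite -ball_normE.
Unshelve. all: by end_near. Qed.

(* No differentiability of f is assumed: 'D is 0 where the limit does not
   exist, and where f has no directional derivative, G \o f has none either
   unless the derivative of G vanishes. *)
Lemma derive_comp_lipschitz f (G : R -> R) x e (d : R) :
  lipschitz_at f x -> is_derive (f x) 1 G d ->
  'D_e (G \o f) x = d * 'D_e f x.
Proof.
move=> fx /is_derive1_caratheodory[g [Gg gc gd]].
have fc := lipschitz_at_continuous fx.
pose q h := h^-1 *: ((f \o shift x) (h *: e) - f x).
pose s h := g (f (h *: e + x)).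
have hx : h *: e + x @[h --> 0^'] --> x.
  rewrite -[X in _ --> X](add0r x) -(scale0r e).
  apply: cvgD; last exact: cvg_cst.
  by apply: cvg_trans (@scalel_continuous _ _ e 0); apply: cvg_app; exact: cvg_within.
have sd : s h @[h --> 0^'] --> d.
  rewrite -gd.
  exact: (@cvg_comp _ _ _ (fun h => h *: e + x) (g \o f) _ _ _ hx (continuous_comp fc gc)).
(* [g] is Caratheodory's slope function of [G] at [f x], defined also where [f] does not move. The
   quotients of [G \o f] therefore factor as [s h * q h], with [s] tending to [d]. *)
have qE : (fun h => h^-1 *: (((G \o f) \o shift x) (h *: e) - (G \o f) x)) =
    (fun h => s h * q h).
  by apply/funext => h; rewrite /= Gg /s /q /= scalerAr.
rewrite /derive qE -/q.
have [qc|qc] := pselect (cvg (q h @[h --> 0^'])).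
  by apply/cvg_lim => //; apply: cvgM sd _; exact: qc.
rewrite (dvgP qc) [X in d * X](_ : point = 0)// mulr0.
(* Here [q] has no limit and the right side is the default 0. If [d] is nonzero, a limit of
   [s h * q h] divided by that of [s] would be a limit of [q], so there is none and the left side is
   the default too. If [d] is 0, the Lipschitz bound keeps [q] bounded while [s] tends to 0, so the
   limit exists and is 0. *)
have [d0|d0] := eqVneq d 0; last first.
  have [sqc|/dvgP //] := pselect (cvg (s h * q h @[h --> 0^'])).
  exfalso; apply: qc; apply/cvg_ex.
  exists (d^-1 * lim (s h * q h @[h --> 0^'])).
  have : (s h)^-1 * (s h * q h) @[h --> 0^'] --> d^-1 * lim (s h * q h @[h --> 0^']).
    by apply: cvgM => //; exact: cvgV.
  apply: cvg_trans; apply: near_eq_cvg; near=> h.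
  by rewrite mulrA mulVf ?mul1r//; near: h; exact: (cvgr_neq0 _ sd).
apply/cvg_lim => //.
case: fx => k fk.
apply/cvgr0Pnorm_le => eps eps0.
have k0 : 0 < `|k| * `|e| + 1 by rewrite ltr_wpDl// mulr_ge0.
rewrite d0 in sd; have /cvgr0Pnorm_le/(_ _ (divr_gt0 eps0 k0)) s0 := sd.
near=> h.
have h0 : h != 0 by near: h; exact: nbhs_dnbhs_neq.
have sh : `|s h| <= eps / (`|k| * `|e| + 1) by near: h.
have qh : `|q h| <= `|k| * `|e| + 1.
  rewrite /q normrZ normfV ler_pdivrMl ?normr_gt0//=.
  have : `|f (h *: e + x) - f x| <= k * `|h *: e + x - x| by near: h; exact: (hx _ fk).
  move=> /le_trans; apply; rewrite addrK normrZ mulrCA ler_wpM2l//.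
  by rewrite (@le_trans _ _ (`|k| * `|e|)) ?lerDl// ler_wpM2r// ler_norm.
by rewrite normrM (le_trans (ler_pM _ _ sh qh))// divfK// gt_eqF.
Unshelve. all: by end_near. Qed.

End chain_rule.

(** * Compactly supported Lipschitz functions and their compositions *)

Section Lip0.
Context (R : realType) (n : nat).
Local Notation point := 'rV[R]_n.+1.
Implicit Types (Omega : set point) (f : point -> R).

(** Outside [Omega] the function vanishes near [x], because its closed support lies in [Omega]; so
    the bound holds on the whole space. *)
Lemma Lip0_lipschitz_at Omega f x : Lip0 Omega f -> lipschitz_at f x.
Proof.
move=> [fl _ fO]; have [/fl|nOx] := pselect (Omega x); last first.
  have nx : (~` closure [set y | f y != 0]) x by move/fO.
  have f0 y : (~` closure [set y | f y != 0]) y -> f y = 0.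
    by move=> ny; apply/eqP; apply: contrapT => /negP fy; exact/ny/subset_closure.
  exists 0; have := open_nbhs_nbhs (conj (closed_openC (@closed_closure _ _)) nx).
  by apply: filterS => y /f0 ->; rewrite f0// subrr normr0 mul0r.
move=> -[U Ux [M [_ HM]]].
(* The Lipschitz hypothesis gives its inequality only for constants strictly above [M], whence the
   added 1. *)
exists (Num.max M 0 + 1); near=> y; apply: (HM (Num.max M 0 + 1) _ (y, x)).
  by rewrite (@le_lt_trans _ _ (Num.max M 0)) ?le_max ?lexx// ltrDl.
by split => /=; [near: y|exact: nbhs_singleton].
Unshelve. all: by end_near. Qed.

(** [G 0 = 0] keeps the support of the composition inside that of [f]. *)
Lemma Lip0_comp Omega f (G : R -> R) (k : R) :
  Lip0 Omega f -> G 0 = 0 -> (forall s t, `|G s - G t| <= k * `|s - t|) ->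
  Lip0 Omega (G \o f).
Proof.
move=> [fl fc fO] G0 Gk.
have sub : closure [set x | (G \o f) x != 0] `<=` closure [set x | f x != 0].
  by apply: closure_subset => x /=; apply: contra_neq => ->.
split; last exact: subset_trans fO.
- move=> x Ox; have [U Ux [M [_ HM]]] := fl x Ox; exists U => //.
  pose M1 := Num.max M 0 + 1.
  exists (`|k| * M1); split; first exact: num_real.
  move=> N /ltW kN [y z] /= yzU; apply: (@le_trans _ _ (`|k| * M1 * `|y - z|)).
    2: by rewrite ler_wpM2r.
  apply: le_trans (Gk _ _) _; rewrite (le_trans (ler_wpM2r _ (ler_norm _)))//.
  rewrite -mulrA ler_wpM2l//; apply: (HM M1 _ (y, z)) => //.
  by rewrite (@le_lt_trans _ _ (Num.max M 0)) ?le_max ?lexx// ltrDl.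
- by apply: subclosed_compact sub => //; exact: closed_closure.
Qed.

Lemma grad_comp Omega f (G : R -> R) (x : point) (d : R) :
  Lip0 Omega f -> is_derive (f x) 1 G d ->
  grad (G \o f) x = d *: grad f x.
Proof.
move=> f0 Gd; apply/colP => i; rewrite !mxE.
by rewrite (derive_comp_lipschitz _ (Lip0_lipschitz_at _ f0) Gd).
Qed.

End Lip0.

Lemma difference_quotient_continuous (R : realType) (V : normedModType R)
    (f : V -> R) (e : V) (h : R) :
  continuous f -> continuous (fun x => h^-1 * (f (h *: e + x) - f x)).
Proof.
move=> fc x; apply: cvgM; first exact: cvg_cst.
apply: cvgB; last exact: fc.
have hc : h *: e + y @[y --> x] --> h *: e + x.
  by apply: cvgD; [exact: cvg_cst|exact: cvg_id].
exact: (@cvg_comp _ _ _ (fun y => h *: e + y) f _ _ _ hc (fc _)).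
Qed.

Lemma closed_le_dist (R : realType) (T : topologicalType) (f g : T -> R) (c : R) :
  continuous f -> continuous g -> closed [set x | `|f x - g x| <= c].
Proof.
move=> fc gc; apply: (@closed_comp _ _ (fun x => `|f x - g x|) [set y | y <= c]).
  by move=> x _; apply: cvg_norm; exact: cvgB (fc x) (gc x).
exact: closed_le.
Qed.

Section measurable_gradient.
Context (R : realType) (n : nat).
Local Notation point := 'rV[R]_n.+1.

(* The directional derivatives exist exactly where the difference quotients
   are Cauchy, and for f continuous this is a countable intersection of
   countable unions of closed sets. *)
Lemma derive_lebesgue_measurable (f : point -> R) (e : point) :
  continuous f -> measurable_fun setT ('D_e f : lebRn R n -> R).
Proof.
move=> fc.
pose q (h : R) x := h^-1 * (f (h *: e + x) - f x).
have qc h : continuous (q h) by exact: difference_quotient_continuous.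
pose C (m k : nat) := [set x | forall h l, 0 < `|h| < k.+1%:R^-1 ->
  0 < `|l| < k.+1%:R^-1 -> `|q h x - q l x| <= m.+1%:R^-1].
have mC m k : measurable (C m k : set (lebRn R n)).
  rewrite -(setCK (C m k)); apply: measurableC; apply: open_lebesgue_measurable.
  rewrite openC.
  have -> : C m k = \bigcap_(hl in [set hl : R * R | 0 < `|hl.1| < k.+1%:R^-1 /\
    0 < `|hl.2| < k.+1%:R^-1]) [set x | `|q hl.1 x - q hl.2 x| <= m.+1%:R^-1].
    apply/seteqP; split => [x Cx [h l] [/= h0 l0]|x Cx h l h0 l0]; first exact: Cx.
    exact: (Cx (h, l)).
  apply: closed_bigI => -[h l] _ /=.
  exact: closed_le_dist.
pose E := \bigcap_m \bigcup_k C m k.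
have mE : measurable (E : set (lebRn R n)).
  by apply: bigcapT_measurable => m; apply: bigcupT_measurable => k; exact: mC.
have DE x : 'D_e f x = lim (q h x @[h --> 0^']) by [].
have cE x : cvg (q h x @[h --> 0^']) <-> E x.
  split=> [/cvg_ex[l ql] m _|Ex].
    have e0 : 0 < m.+1%:R^-1 / 2 :> R by rewrite divr_gt0.
    have /cvgrPdist_lt/(_ _ e0) /= := ql.
    move=> /nbhs_ballP[d /= d0 qd].
    have [k _ kd] := near_infty_natSinv_lt (PosNum d0).
    exists k => // h h' /andP[h0 hk] /andP[h'0 h'k].
    have qlh u : 0 < `|u| -> `|u| < k.+1%:R^-1 -> `|l - q u x| < m.+1%:R^-1 / 2.
      move=> u0 uk; apply: qd; last by rewrite -normr_gt0.
      by rewrite /ball /= sub0r normrN (lt_trans uk)//; exact: (kd k (leqnn k)).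
    have := qlh _ h0 hk; have := qlh _ h'0 h'k.
    rewrite !ltr_norml ler_norml; move: (q h x) (q h' x) (m.+1%:R^-1) => a b c.
    by move=> /andP[? ?] /andP[? ?]; apply/andP; split; lra.
  apply: cauchy_cvg; apply: cauchy_exP => eps /= eps0.
  have [m _ me] := near_infty_natSinv_lt (PosNum eps0).
  have [k _ Ck] := Ex m I.
  have k0 : 0 < k.+1%:R^-1 / 2 :> R by rewrite divr_gt0.
  have kk : k.+1%:R^-1 / 2 < k.+1%:R^-1 :> R.
    by rewrite ltr_pdivrMr// ltr_pMr ?invr_gt0// ltr1n.
  exists (q (k.+1%:R^-1 / 2) x); apply/nbhs_ballP; exists k.+1%:R^-1 => /= [|h].
    by rewrite invr_gt0.
  rewrite /ball /= sub0r normrN => hk h0.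
  apply: le_lt_trans (me m (leqnn m)); apply: Ck; first by rewrite gtr0_norm// k0.
  by rewrite normr_gt0 h0.
(* Off [E] this sequence is 0, which is also the default value of ['D] there, so it converges to
   ['D_e f] at every point. *)
pose g k x := \1_E x * q k.+1%:R^-1 x.
apply: (@measurable_fun_cvg _ (lebRn R n) R _ g).
  move=> k; apply: measurable_funM; first exact: measurable_indic.
  by apply: (continuous_lebesgue_measurable openT) => x _; exact: qc.
move=> x _; rewrite DE /g.
have [Ex|nEx] := pselect (E x); last first.
  rewrite dvgP; last by move/cE.
  by under eq_fun do rewrite indicE memNset// mul0r; exact: cvg_cst.
under eq_fun do rewrite indicE mem_set// mul1r.
have /cE qx := Ex.
apply: cvg_comp qx => P /nbhs_ballP[d /= d0 Pd].
have [k _ kd] := near_infty_natSinv_lt (PosNum d0).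
exists k => // j /= kj; apply: Pd; last by rewrite invr_eq0 pnatr_eq0.
by rewrite /ball /= sub0r normrN ger0_norm ?invr_ge0//; exact: (kd j).
Qed.

Lemma grad_lebesgue_measurable Omega (f : point -> R) :
  open Omega -> Lip0 Omega f -> vec_measurable Omega (grad f).
Proof.
move=> oO f0 i; rewrite /lebesgue_measurable /grad.
under eq_fun do rewrite mxE.
apply: measurable_funTS; apply: derive_lebesgue_measurable => x.
exact: lipschitz_at_continuous (Lip0_lipschitz_at x f0).
Qed.

End measurable_gradient.

(** * Truncated exponentials *)

Section powR_inequalities.
Context {R : realType}.
Implicit Types (p a b c x y : R).

Lemma ler_powR2r p x y : 0 <= p -> 0 <= x -> x <= y -> x `^ p <= y `^ p.
Proof. by move=> ? x0 xy; apply: ge0_ler_powR; rewrite ?nnegrE// (le_trans x0). Qed.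

Lemma powRB2_mul p a : 1 < p -> 0 <= a -> a `^ (p - 2) * a = a `^ (p - 1).
Proof.
move=> p1; rewrite le_eqVlt => /predU1P[<-|a0].
  by rewrite mulr0 powR0// subr_eq0 gt_eqF.
rewrite -{2}(powRr1 (ltW a0)) -powRD; last by rewrite (gt_eqF a0) implybT.
by congr (_ `^ _); ring.
Qed.

(** The p-th power of the larger of [a] and [b] dominates the product. This crude Young inequality
    serves to show that the integrands of the weak formulation are integrable. *)
Lemma powRB1_mul_le p a b : 1 < p -> 0 <= a -> 0 <= b ->
  a `^ (p - 1) * b <= a `^ p + b `^ p.
Proof.
move=> p1 a0 b0; have p0 : 0 < p by exact: lt_trans p1.
have [ab|/ltW ba] := leP a b.
  apply: (@le_trans _ _ (b `^ p)); last by rewrite lerDr powR_ge0.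
  rewrite -(mulr_powRB1 b0 p0) mulrC; apply: ler_wpM2l => //.
  by apply: ler_powR2r => //; rewrite subr_ge0 ltW.
apply: (@le_trans _ _ (a `^ p)); last by rewrite lerDl powR_ge0.
by rewrite -(mulr_powRB1 a0 p0) mulrC; apply: ler_wpM2r => //; exact: powR_ge0.
Qed.

Lemma powR_add_le p a b : 0 <= p -> 0 <= a -> 0 <= b ->
  (a + b) `^ p <= 2 `^ p * a `^ p + 2 `^ p * b `^ p.
Proof.
move=> p0 a0 b0; have ab0 : 0 <= a + b by exact: addr_ge0.
have [ab|/ltW ba] := leP a b.
  apply: (@le_trans _ _ ((2 * b) `^ p)).
    by apply: ler_powR2r => //; rewrite mulr2n mulrDl mul1r lerD2r.
  by rewrite powRM// lerDr mulr_ge0 ?powR_ge0.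
apply: (@le_trans _ _ ((2 * a) `^ p)).
  by apply: ler_powR2r => //; rewrite mulr2n mulrDl mul1r lerD2l.
by rewrite powRM// lerDl mulr_ge0 ?powR_ge0.
Qed.

(** To be read with a, b, c the lengths of sqrt(Q) applied to gradu, to gradu - grad psi and to grad
    psi. If 2b <= a, then c <= 2a and the subtracted term takes at most half of a^p. Otherwise c <=
    4b, the difference of the first two terms is at least -b^p, and 2 b^p <= 2^p b^p. In both cases
    the factor 2^(-(p+1)) turns c^p into at most half of the dominant term. *)
Lemma powR_coercive p a b c : 1 < p -> 0 <= a -> 0 <= b -> 0 <= c ->
  c <= a + b ->
  2 `^ (- (p + 1)) * c `^ p <= a `^ p - a `^ (p - 1) * b + 2 `^ p * b `^ p.
Proof.
move=> p1 a0 b0 c0 cab; have p0 : 0 < p by exact: lt_trans p1.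
have q0 : 0 <= p - 1 by rewrite subr_ge0 ltW.
have E2 : 2 `^ (- (p + 1)) * 2 `^ p = 2^-1 :> R.
  rewrite -powRD; last by rewrite pnatr_eq0 implybT.
  by rewrite opprD addrAC addNr sub0r powR_inv1.
have [ab|ab] := leP (2 * b) a.
  have /(ler_powR2r (ltW p0) c0) : c <= 2 * a by lra.
  move/(ler_wpM2l (powR_ge0 2 (- (p + 1)))) => /le_trans; apply.
  rewrite powRM// mulrA E2.
  have : 0 <= 2 `^ p * b `^ p by rewrite mulr_ge0 ?powR_ge0.
  have : a `^ (p - 1) * b <= 2^-1 * a `^ p.
    rewrite -(mulr_powRB1 a0 p0) mulrA mulrC ler_wpM2r ?powR_ge0//; lra.
  lra.
have /(ler_powR2r (ltW p0) c0) : c <= 2 * (2 * b) by lra.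
move/(ler_wpM2l (powR_ge0 2 (- (p + 1)))) => /le_trans; apply.
have b20 : 0 <= 2 * b by lra.
rewrite powRM// mulrA E2 powRM//.
have bp : 2 * b `^ p <= 2 `^ p * b `^ p.
  by rewrite ler_wpM2r ?powR_ge0// le1r_powR ?ler1n// ltW.
have : - b `^ p <= a `^ p - a `^ (p - 1) * b.
  rewrite -(mulr_powRB1 a0 p0) -(mulr_powRB1 b0 p0).
  have [ba|/ltW ab'] := leP b a.
    apply: (@le_trans _ _ 0).
      by rewrite oppr_le0 mulr_ge0 ?powR_ge0.
    by rewrite mulrC -mulrBr mulr_ge0 ?powR_ge0// subr_ge0.
  have := ler_powR2r q0 a0 ab'; have := powR_ge0 a (p - 1).
  move: (a `^ _) (b `^ _) => A B A0 AB.
  have : 0 <= a * A by rewrite mulr_ge0.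
  have : 0 <= b * (B - A) by rewrite mulr_ge0// subr_ge0.
  lra.
lra.
Qed.

End powR_inequalities.

Section real_functions.
Context {R : realType}.
Implicit Types (f F K G h : R -> R).

(** Cutting at 0 gives a function continuous on the whole line; composed with a nonnegative
    continuous h it shows that h^p is continuous, also where h vanishes. *)
Lemma powR_max0_continuous (p : R) :
  0 < p -> continuous (fun x : R => Num.max x 0 `^ p).
Proof.
move=> p0 x; have [x0|x0|->] := ltgtP x 0.
- rewrite /continuous_at (max_idPr (ltW x0)) powR0 ?gt_eqF//.
  apply: cvg_near_cst; near=> y.
  rewrite (max_idPr _) ?powR0 ?gt_eqF//.
  by near: y; exact: lt_le_nbhsl.
- have dp : derivable (fun y : R => y `^ p) x 1.
    by apply: derivable_powR; rewrite in_itv /= x0.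
  have pc : {for x, continuous (fun y : R => y `^ p)}.
    exact/differentiable_continuous/derivable1_diffP.
  rewrite /continuous_at (max_idPl (ltW x0)); apply: cvg_trans pc.
  apply: near_eq_cvg; near=> y; rewrite (max_idPl _)//.
  by near: y; exact: lt_le_nbhsr.
- rewrite /continuous_at maxxx powR0 ?gt_eqF//.
  apply/cvgr0Pnorm_le => e e0.
  have d0 : 0 < e `^ p^-1 by exact: powR_gt0.
  have cid : (id y : R) @[y --> (0 : R)] --> (0 : R) by exact: cvg_id.
  have /cvgr0Pnorm_le/(_ _ d0) n0 := cid.
  near=> y.
  have y0 : `|y| <= e `^ p^-1 by near: y.
  rewrite ger0_norm ?powR_ge0// (@le_trans _ _ ((e `^ p^-1) `^ p))//.
    apply: ge0_ler_powR; rewrite ?nnegrE ?powR_ge0 ?(ltW p0)//.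
      by rewrite le_max lexx orbT.
    by rewrite ge_max powR_ge0 andbT (le_trans (ler_norm _)).
  by rewrite -powRrM mulVf ?gt_eqF// powRr1// ltW.
Unshelve. all: by end_near. Qed.

Lemma primitive_exists f : continuous f -> (forall t, t <= 0 -> f t = 0) ->
  exists2 F, forall x : R, is_derive x 1 F (f x) & forall t, t <= 0 -> F t = 0.
Proof.
move=> fc f0.
(* Starting at -1 adds nothing, since [f] vanishes on the left of 0, and makes every x >= 0 an
   interior point of the interval, 0 included. *)
pose F x := (\int[lebesgue_measure]_(t in `[-1, x]) f t)%R.
have F0 t : t <= 0 -> F t = 0.
  move=> t0; rewrite /F /Rintegral integral0_eq// => x /=.
  by rewrite in_itv /= => /andP[_ xt]; rewrite f0// (le_trans xt).
exists F => // x; have [x0|x0] := ltP x 0.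
  rewrite f0 ?ltW//; apply: near_eq_is_derive (is_derive_cst 0 _ _).
  near=> y; rewrite F0 ?cst_apply//.
  by near: y; exact: lt_le_nbhsl.
have x1 : x < x + 1 by rewrite ltrDl.
have fi : lebesgue_measure.-integrable `[-1, x + 1] (EFin \o f).
  apply: continuous_compact_integrable; first exact: segment_compact.
  exact: continuous_subspaceT.
have x1' : -1 < x by rewrite (lt_le_trans _ x0)// ltrN10.
have [dF FE] := continuous_FTC1_closed x1 fi x1' (fc x).
by apply: DeriveDef; [exact: dF|rewrite -derive1E FE].
Unshelve. all: by end_near. Qed.

Lemma is_derive_continuous F f : (forall x : R, is_derive x 1 F (f x)) ->
  continuous F.
Proof.
move=> dF x; have [dFx _] := dF x.
exact/differentiable_continuous/derivable1_diffP.
Qed.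

Lemma le_is_derive F1 F2 f1 f2 (a b : R) : a <= b ->
  (forall x : R, is_derive x 1 F1 (f1 x)) ->
  (forall x : R, is_derive x 1 F2 (f2 x)) ->
  (forall x, a <= x <= b -> f1 x <= f2 x) ->
  F1 b - F1 a <= F2 b - F2 a.
Proof.
move=> ab d1 d2 f12; pose D := F2 - F1.
have dD (x : R) : is_derive x 1 D (f2 x - f1 x) by exact: is_deriveB.
have [|c cab Dc] := @MVT_segment R D (fun x => f2 x - f1 x) a b ab (fun x _ => dD x).
  exact/continuous_subspaceT/(is_derive_continuous dD).
have : 0 <= D b - D a.
  by rewrite Dc mulr_ge0// subr_ge0// f12//; move: cab; rewrite in_itv.
by rewrite /D !fctE; lra.
Qed.

Lemma lipschitz_is_derive F f (M : R) : (forall x : R, is_derive x 1 F (f x)) ->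
  (forall x, `|f x| <= M) -> forall s t, `|F s - F t| <= M * `|s - t|.
Proof.
move=> dF fM s t; wlog ts : s t / t <= s.
  move=> wl; have [/wl//|/ltW/wl] := leP t s.
  by rewrite distrC [X in _ <= _ * X]distrC.
have [|c _ ->] := @MVT_segment R F f t s ts (fun x _ => dF x).
  exact/continuous_subspaceT/(is_derive_continuous dF).
by rewrite normrM ler_wpM2r.
Qed.

Definition clip (L t : R) := Num.min (Num.max t 0) L.
Definition frozen_exp (g L t : R) := expR (g * clip L t) - 1.

Lemma clip_ge0 L t : 0 <= L -> 0 <= clip L t.
Proof. by move=> L0; rewrite le_min L0 le_max lexx orbT. Qed.

Lemma clip_le L t : clip L t <= L. Proof. by rewrite ge_min lexx orbT. Qed.

Lemma clip_homo L s t : s <= t -> clip L s <= clip L t.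
Proof.
by move=> st; rewrite /clip /Num.min /Num.max; do !case: ifPn;
  rewrite -?leNgt; lra.
Qed.

Lemma clip_continuous L : continuous (clip L).
Proof.
move=> t; apply: (@continuous_min R _ (fun t : R => Num.max t 0) (fun=> L)).
  apply: (@continuous_max R _ (fun t : R => t) (fun=> 0)); first exact: cvg_id.
  exact: cvg_cst.
exact: cvg_cst.
Qed.

Section frozen_exp.
Context (g L : R) (g0 : 0 < g) (L0 : 0 <= L).
Local Notation h := (frozen_exp g L).

Lemma frozen_exp_continuous : continuous h.
Proof.
move=> t; apply: cvgB; last exact: cvg_cst.
apply: (@continuous_comp _ _ _ (fun t => g * clip L t) expR); last exact: continuous_expR.
by apply: cvgM; [exact: cvg_cst|exact: clip_continuous].
Qed.

Lemma frozen_exp_ge0 t : 0 <= h t.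
Proof. by rewrite subr_ge0 -expR0 ler_expR mulr_ge0 ?clip_ge0// ltW. Qed.

Lemma frozen_exp_homo s t : s <= t -> h s <= h t.
Proof.
by move=> st; rewrite lerB// ler_expR ler_wpM2l ?clip_homo// ltW.
Qed.

Lemma frozen_exp_le t : h t <= expR (g * L) - 1.
Proof. by rewrite lerB// ler_expR ler_wpM2l ?clip_le// ltW. Qed.

Lemma frozen_exp_le0 t : t <= 0 -> h t = 0.
Proof.
move=> t0; rewrite /frozen_exp /clip (max_idPr t0) (min_idPl L0) mulr0 expR0.
by rewrite subrr.
Qed.

(** With s the clipped value of t, integrating h from 0 to s gives g K(t) >= g K(s) = exp(g s) - 1 -
    g s. As 2 g s <= exp(g s), doubling leaves 2 g K(t) >= exp(g s) - 2 = h(t) - 1. *)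
Lemma frozen_exp_primitive_lb K : (forall t : R, is_derive t 1 K (h t)) ->
  (forall t, t <= 0 -> K t = 0) -> forall t, h t <= 2 * g * K t + 1.
Proof.
move=> dK K0 t; have [t0|/ltW t0] := leP t 0.
  by rewrite frozen_exp_le0// K0// mulr0 add0r.
pose s := clip L t.
have s0 : 0 <= s by exact: clip_ge0.
have st : s <= t by rewrite /s /clip (max_idPl t0) ge_min lexx.
have Kst : K s <= K t.
  have := le_is_derive st (fun x : R => is_derive_cst (0 : R) x 1) dK
    (fun x _ => frozen_exp_ge0 x).
  by rewrite /cst subrr subr_ge0.
pose E x := g^-1 * expR (g * x) - x.
have dE (x : R) : is_derive x 1 E (expR (g * x) - 1).
  have gx : is_derive x 1 (fun x : R => g * x) g.
    by have := @is_deriveZ _ _ _ id g x 1 _ (is_derive_id _ _); rewrite scaler1.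
  apply: is_deriveB.
  have -> : expR (g * x) = g^-1 *: (expR (g * x) * g).
    by rewrite /GRing.scale /= mulrCA mulVf ?mulr1// gt_eqF.
  by apply: is_deriveZ; exact: is_derive1_comp.
have : E s - E 0 <= K s - K 0.
  apply: le_is_derive s0 dE dK _ => x /andP[x0 xs].
  rewrite /frozen_exp lerB// ler_expR ler_wpM2l ?(ltW g0)//.
  by rewrite /clip (max_idPl x0) le_min lexx (le_trans xs)// clip_le.
rewrite (K0 0)// subr0 /E mulr0 expR0 mulr1 subr0 => Ks.
(* For a >= 0, exp(a) >= (1 + a/2)^2, which exceeds 2a by the square of 1 - a/2. *)
have : 2 * (g * s) <= expR (g * s).
  have : 0 <= g * s by rewrite mulr_ge0// ltW.
  move: (g * s) => a a0; rewrite (_ : expR a = expR (a / 2) * expR (a / 2)); last first.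
    by rewrite -expRD; congr expR; field.
  have b0 : 0 <= 1 + a / 2 by rewrite addr_ge0// divr_ge0.
  apply: le_trans (ler_pM b0 b0 (expR_ge1Dx _) (expR_ge1Dx _)).
  by have := sqr_ge0 (1 - a / 2); rewrite expr2; lra.
rewrite /frozen_exp -/s.
have : g * (g^-1 * expR (g * s) - s - g^-1) <= g * K t.
  by rewrite ler_wpM2l ?(ltW g0)// (le_trans Ks).
rewrite [X in X <= _](_ : _ = expR (g * s) - g * s - 1); last first.
  by field; rewrite gt_eqF.
by rewrite -(mulrA 2 g); lra.
Qed.

(** Since h is nondecreasing, h^p <= h(t)^(p-1) h on [0, t]; then integrate. *)
Lemma frozen_exp_powR_primitive_le K G (p : R) : 1 < p ->
  (forall t : R, is_derive t 1 K (h t)) -> (forall t, t <= 0 -> K t = 0) ->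
  (forall t : R, is_derive t 1 G (h t `^ p)) -> (forall t, t <= 0 -> G t = 0) ->
  forall t, G t <= K t * h t `^ (p - 1).
Proof.
move=> p1 dK K0 dG G0 t; have [t0|/ltW t0] := leP t 0.
  by rewrite G0// K0// mul0r.
have dKh (x : R) : is_derive x 1 (h t `^ (p - 1) \*: K) (h t `^ (p - 1) *: h x).
  exact: is_deriveZ.
have := le_is_derive t0 dG dKh.
rewrite (G0 0)// /= (K0 0)// scaler0 !subr0 /GRing.scale /= mulrC; apply.
move=> x /andP[x0 xt].
rewrite -mulr_powRB1 ?frozen_exp_ge0 ?(lt_trans _ p1)// mulrC.
apply: ler_wpM2r; first exact: frozen_exp_ge0.
apply: ge0_ler_powR; rewrite ?nnegrE.
- by rewrite subr_ge0 ltW.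
- exact: frozen_exp_ge0.
- exact: frozen_exp_ge0.
- exact: frozen_exp_homo.
Qed.

End frozen_exp.

(* The weak formulation is tested with G(u), and the subunit and Sobolev
   inequalities are applied to K(u). Only finiteness of u in L^p is known, so
   h has to be bounded, but eta, C and g below do not depend on the bound. *)
Definition test_triple (p T : R) h K G :=
  [/\ forall t, 0 <= h t <= T, continuous h,
      forall t : R, is_derive t 1 K (h t),
      forall t : R, is_derive t 1 G (h t `^ p) &
      [/\ K 0 = 0, G 0 = 0, forall t, 0 <= K t & forall t, 0 <= G t]].

(** The rate g = a/4 turns the lower bound on K into h <= (a/2) K + 1. Where (a/2) K >= 1 this gives
    h <= a K, hence h^p <= a^p K^p and G <= K h^(p-1) <= a^(p-1) K^p; the choice of [a] makes both
    factors at most eta, the condition a <= 1 taking care of a^p. Elsewhere h and K are bounded by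
    constants free of L. The last claim repeats this with threshold 2 in place of 1. *)
Lemma test_triple_exists (p eta : R) : 1 < p -> 0 < eta ->
  exists2 g, 0 < g & exists2 C, 0 <= C &
  forall L, 0 <= L -> exists T h K G,
  [/\ 0 <= T, test_triple p T h K G,
      forall t, h t `^ p <= eta * K t `^ p + C,
      forall t, G t <= eta * K t `^ p + C &
      forall t, expR (g * clip L t) `^ p <= K t `^ p + 4 `^ p].
Proof.
move=> p1 eta0; have p0 : 0 < p by exact: lt_trans p1.
have q0 : 0 < p - 1 by rewrite subr_gt0.
pose a := Num.min 1 (eta `^ (p - 1)^-1).
have a0 : 0 < a by rewrite lt_min ltr01 powR_gt0.
have a1 : a <= 1 by rewrite ge_min lexx.
have aq : a `^ (p - 1) <= eta.
  rewrite [leRHS](_ : _ = (eta `^ (p - 1)^-1) `^ (p - 1)).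
    by apply: ler_powR2r; [exact: ltW|exact: ltW|rewrite ge_min lexx orbT].
  by rewrite -powRrM mulVf ?gt_eqF// powRr1// ltW.
have ap : a `^ p <= eta.
  by apply: le_trans aq; apply: ger_powR; rewrite ?a0// gerBl.
exists (a / 4); first by rewrite divr_gt0.
(* In the bounded region h <= 2 and K <= 2/a: the first summand bounds h^p, the second K h^(p-1). *)
pose C := 2 `^ p + 2 / a * 2 `^ (p - 1).
have C1 : 0 <= 2 / a * 2 `^ (p - 1) by rewrite mulr_ge0 ?powR_ge0// divr_ge0// ltW.
exists C; first by rewrite addr_ge0 ?powR_ge0.
move=> L L0; set g := a / 4; have g0 : 0 < g by rewrite divr_gt0.
pose h := frozen_exp g L.
have hc : continuous h by exact: frozen_exp_continuous.
have h0 t : 0 <= h t by exact: frozen_exp_ge0.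
have hneg t : t <= 0 -> h t = 0 by exact: frozen_exp_le0.
have [K dK K0] := primitive_exists hc hneg.
have [||G dG G0] := @primitive_exists (fun t => h t `^ p).
- rewrite (_ : (fun t => h t `^ p) = (fun x => Num.max x 0 `^ p) \o h); last first.
    by apply/funext => t /=; rewrite (max_idPl (h0 t)).
  by move=> t; apply: continuous_comp; [exact: hc|exact: powR_max0_continuous].
- by move=> t /hneg ->; rewrite powR0// gt_eqF.
have mono F f : (forall t : R, is_derive t 1 F (f t)) -> (forall t, 0 <= f t) ->
    (forall t, t <= 0 -> F t = 0) -> forall t, 0 <= F t.
  move=> dF f0 F0 t; have [/F0 ->//|/ltW t0] := leP t 0.
  have := le_is_derive t0 (fun x : R => is_derive_cst (0 : R) x 1) dF (fun x _ => f0 x).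
  by rewrite (F0 0)// /cst subrr subr0.
have Kge0 := mono _ _ dK h0 K0.
have Gge0 := mono _ _ dG (fun t => powR_ge0 _ _) G0.
have hK t : h t <= a / 2 * K t + 1.
  have := frozen_exp_primitive_lb g0 L0 dK K0 t; rewrite -/h /g.
  by rewrite (_ : 2 * (a / 4) = a / 2)//; field.
have GK t : G t <= K t * h t `^ (p - 1).
  exact: (frozen_exp_powR_primitive_le g0 L0 p1 dK K0 dG G0).
have aK0 t : 0 <= a * K t by rewrite mulr_ge0// ltW.
exists (expR (g * L) - 1), h, K, G; split.
- by rewrite subr_ge0 -expR0 ler_expR mulr_ge0// ltW.
- split=> //; last by split=> //; [exact: K0|exact: G0].
  by move=> t; rewrite h0; exact: frozen_exp_le.
- move=> t; have [aK|aK] := leP 1 (a / 2 * K t).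
    have hat : h t <= a * K t by have := hK t; lra.
    rewrite (le_trans (ler_powR2r (ltW p0) (h0 t) hat))//.
    rewrite powRM ?(ltW a0)// (le_trans (ler_wpM2r (powR_ge0 _ _) ap))// lerDl.
    by rewrite addr_ge0 ?powR_ge0.
  have ht2 : h t <= 2 by have := hK t; lra.
  rewrite (le_trans (ler_powR2r (ltW p0) (h0 t) ht2))// /C.
  rewrite (le_trans (y := 2 `^ p + 2 / a * 2 `^ (p - 1))) ?lerDl// lerDr.
  by rewrite mulr_ge0 ?powR_ge0// ltW.
- move=> t; apply: (le_trans (GK t)); have [aK|aK] := leP 1 (a / 2 * K t).
    have hat : h t <= a * K t by have := hK t; lra.
    rewrite (le_trans (ler_wpM2l (Kge0 t) (ler_powR2r (ltW q0) (h0 t) hat)))//.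
    rewrite powRM ?(ltW a0)// mulrCA mulr_powRB1//.
    rewrite (le_trans (ler_wpM2r (powR_ge0 _ _) aq))// lerDl.
    by rewrite addr_ge0 ?powR_ge0.
  have ht2 : h t <= 2 by have := hK t; lra.
  have Kt2 : K t <= 2 / a.
    by rewrite ler_pdivlMr// mulrC; lra.
  apply: (le_trans (ler_pM (Kge0 t) (powR_ge0 _ _) Kt2
    (ler_powR2r (ltW q0) (h0 t) ht2))).
  rewrite /C addrA lerDr addr_ge0 ?powR_ge0// mulr_ge0 ?powR_ge0//.
  exact: ltW.
- move=> t; have hE : expR (g * clip L t) = h t + 1 by rewrite /h /frozen_exp subrK.
  have h10 : 0 <= h t + 1 by rewrite addr_ge0.
  rewrite hE; have [aK|aK] := leP 2 (a / 2 * K t).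
    have hat : h t + 1 <= a * K t by have := hK t; lra.
    apply: le_trans (ler_powR2r (ltW p0) h10 hat) _.
    have aKK : a * K t <= K t by rewrite ler_piMl.
    apply: le_trans (ler_powR2r (ltW p0) (aK0 t) aKK) _.
    by rewrite lerDl powR_ge0.
  have ht4 : h t + 1 <= 4 by have := hK t; lra.
  apply: le_trans (ler_powR2r (ltW p0) h10 ht4) _.
  by rewrite lerDr powR_ge0.
Qed.

End real_functions.

(** * Energy estimate *)

Section energy.
Context d (T : measurableType d) (R : realType).
Context (mu : {measure set T -> \bar R}) (D : set T) (mD : measurable D).
Local Notation I f := (\int[mu]_(x in D) (f x)%:E)%E.

Definition nn_measurable (f : T -> R) :=
  measurable_fun D f /\ forall x, D x -> 0 <= f x.

Lemma measurable_powR_fun (f : T -> R) (p : R) :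
  measurable_fun D f -> measurable_fun D (fun x => f x `^ p).
Proof. by move=> mf; exact: (measurableT_comp (measurable_powR p)). Qed.

Lemma nn_powR (f : T -> R) (p : R) :
  measurable_fun D f -> nn_measurable (fun x => f x `^ p).
Proof.
by move=> mf; split; [exact: measurable_powR_fun|move=> x _; exact: powR_ge0].
Qed.

Lemma nn_mul (f g : T -> R) : nn_measurable f -> nn_measurable g ->
  nn_measurable (fun x => f x * g x).
Proof.
move=> [mf f0] [mg g0]; split; first exact: measurable_funM.
by move=> x Dx; rewrite mulr_ge0 ?f0 ?g0.
Qed.

Lemma nn_add (f g : T -> R) : nn_measurable f -> nn_measurable g ->
  nn_measurable (fun x => f x + g x).
Proof.
move=> [mf f0] [mg g0]; split; first exact: measurable_funD.
by move=> x Dx; rewrite addr_ge0 ?f0 ?g0.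
Qed.

Lemma nn_integral_ge0 f : nn_measurable f -> (0 <= I f)%E.
Proof. by move=> [_ f0]; apply: integral_ge0 => x Dx; rewrite lee_fin f0. Qed.

Lemma nn_le_integral f g : nn_measurable f -> nn_measurable g ->
  (forall x, D x -> f x <= g x) -> (I f <= I g)%E.
Proof.
move=> [mf f0] [mg g0] fg.
have f0' x : D x -> (0 <= (f x)%:E)%E by rewrite lee_fin; exact: f0.
have mf' : measurable_fun D (fun x => (f x)%:E) by exact/measurable_EFinP.
have mg' : measurable_fun D (fun x => (g x)%:E) by exact/measurable_EFinP.
have fg' x : D x -> ((f x)%:E <= (g x)%:E)%E by rewrite lee_fin; exact: fg.
exact: ge0_le_integral.
Qed.

Lemma nn_integralZ f (a : R) : 0 <= a -> nn_measurable f ->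
  (I (fun x => a * f x)%R = a%:E * I f)%E.
Proof.
move=> a0 [mf f0]; under eq_integral do rewrite EFinM.
have f0' x : D x -> (0 <= (f x)%:E)%E by rewrite lee_fin; exact: f0.
have mf' : measurable_fun D (fun x => (f x)%:E) by exact/measurable_EFinP.
exact: ge0_integralZl_EFin.
Qed.

Lemma nn_integralD f g : nn_measurable f -> nn_measurable g ->
  (I (fun x => f x + g x)%R = I f + I g)%E.
Proof.
move=> [mf f0] [mg g0]; under eq_integral do rewrite EFinD.
have f0' x : D x -> (0 <= (f x)%:E)%E by rewrite lee_fin; exact: f0.
have mf' : measurable_fun D (fun x => (f x)%:E) by exact/measurable_EFinP.
have g0' x : D x -> (0 <= (g x)%:E)%E by rewrite lee_fin; exact: g0.
have mg' : measurable_fun D (fun x => (g x)%:E) by exact/measurable_EFinP.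
exact: ge0_integralD.
Qed.

Lemma nn_cst (a : R) : 0 <= a -> nn_measurable (fun=> a).
Proof. by move=> a0; split. Qed.

(** Many of the integral estimates below are instances of this; a single majorant is handled by a
    zero second coefficient. *)
Lemma nn_integral_le_lin f g1 g2 (a b c1 c2 : R) :
  nn_measurable f -> nn_measurable g1 -> nn_measurable g2 ->
  0 <= a -> 0 <= b -> (forall x, D x -> f x <= a * g1 x + b * g2 x) ->
  (I g1 <= c1%:E)%E -> (I g2 <= c2%:E)%E -> (I f <= (a * c1 + b * c2)%:E)%E.
Proof.
move=> nf n1 n2 a0 b0 fg I1 I2.
have na : nn_measurable (fun x => a * g1 x) by apply: nn_mul => //; exact: nn_cst.
have nb : nn_measurable (fun x => b * g2 x) by apply: nn_mul => //; exact: nn_cst.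
apply: (le_trans (nn_le_integral nf (nn_add na nb) fg)).
rewrite nn_integralD// !nn_integralZ// EFinD !EFinM.
by apply: leeD; rewrite lee_wpmul2l ?lee_fin.
Qed.

Lemma nn_integral_lty_lin f g1 g2 (a b : R) :
  nn_measurable f -> nn_measurable g1 -> nn_measurable g2 ->
  0 <= a -> 0 <= b -> (forall x, D x -> f x <= a * g1 x + b * g2 x) ->
  (I g1 < +oo)%E -> (I g2 < +oo)%E -> (I f < +oo)%E.
Proof.
move=> nf n1 n2 a0 b0 fg I1 I2.
have fin g : nn_measurable g -> (I g < +oo)%E -> (I g <= (fine (I g))%:E)%E.
  by move=> ng Ig; rewrite fineK// ge0_fin_numE// nn_integral_ge0.
have := nn_integral_le_lin nf n1 n2 a0 b0 fg (fin _ n1 I1) (fin _ n2 I2).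
by move=> /le_lt_trans; apply; rewrite ltry.
Qed.

Lemma nn_integrable f : nn_measurable f -> (I f < +oo)%E ->
  mu.-integrable D (EFin \o f).
Proof.
move=> [mf f0] If; apply/integrableP; split; first exact/measurable_EFinP.
rewrite (eq_integral (fun x => (f x)%:E))// => x /set_mem xD.
by rewrite /= ger0_norm ?f0.
Qed.

(* Here A, P, B are the lengths of sqrt(Q) grad u, sqrt(Q) grad psi and of their
   difference, s is |sqrt(Q) grad u|^(p-2) <grad psi, Q grad u>, and tau is
   |t . grad psi|. All terms on the right are absorbed into
   I (h(psi)^p P^p), the constant X0 being independent of the truncation. *)
Lemma energy_estimate (p c1 c2 V : R) :
  1 < p -> 0 <= c1 -> 0 < c2 -> 0 <= V -> exists2 eta : R, 0 < eta &
  forall C : R, 0 <= C -> exists2 X0 : R, 0 <= X0 &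
  forall (v psi A P B s tau : T -> R) (N b : R) (h K G : R -> R),
  0 <= N -> test_triple p N h K G ->
  (forall t, h t `^ p <= eta * K t `^ p + C) ->
  (forall t, G t <= eta * K t `^ p + C) ->
  nn_measurable v -> (I v <= V%:E)%E ->
  measurable_fun D psi -> nn_measurable A -> nn_measurable P ->
  nn_measurable B -> measurable_fun D s -> nn_measurable tau ->
  (I (fun x => A x `^ p) < +oo)%E ->
  (I (fun x => B x `^ p) <= b%:E)%E -> 2 `^ p * N `^ p * b <= 1 ->
  (forall x, D x -> P x <= A x + B x) ->
  (forall x, D x -> `|s x| <= A x `^ (p - 1) * P x) ->
  (forall x, D x -> 2 `^ (- (p + 1)) * P x `^ p <= s x + 2 `^ p * B x `^ p) ->
  (I (fun x => h (psi x) `^ p * s x)%R <=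
   I (fun x => (G (psi x) + h (psi x) `^ p * tau x) * v x)%R)%E ->
  (I (fun x => (h (psi x) * tau x) `^ p * v x)%R <=
   c1%:E * I (fun x => h (psi x) `^ p * P x `^ p)%R)%E ->
  (forall Z : R, 0 < Z -> (I (fun x => h (psi x) `^ p * P x `^ p)%R <= Z%:E)%E ->
    (I (fun x => K (psi x) `^ p * v x)%R <= (c2 * Z)%:E)%E) ->
  (I (fun x => K (psi x) `^ p * v x)%R <= X0%:E)%E.
Proof.
move=> p1 c10 c20 V0; have p0 : 0 < p by exact: lt_trans p1.
have q0 : 0 < p - 1 by rewrite subr_gt0.
(* A quarter of the coercivity constant: one quarter will absorb the [tau] term, one the [G] and [h]
   terms, and two remain. *)
pose kap : R := 2 `^ (- (p + 1)) / 4.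
have kap0 : 0 < kap by rewrite divr_gt0 ?powR_gt0.
(* [M] is the threshold of the splitting: tau <= M where tau is small, and tau <= M^(1-p) tau^p = e
   tau^p elsewhere. Its value makes e c1 <= kap. *)
pose M := ((c1 + 1) / kap) `^ (p - 1)^-1.
have c1k : 0 < (c1 + 1) / kap by rewrite divr_gt0 ?ltr_wpDl.
have M0 : 0 < M by exact: powR_gt0.
have ME : M `^ (p - 1) = (c1 + 1) / kap.
  by rewrite /M -powRrM mulVf ?gt_eqF// powRr1// ltW.
pose e := (M `^ (p - 1))^-1.
have e0 : 0 < e by rewrite invr_gt0 powR_gt0.
have ec1 : e * c1 <= kap.
  rewrite /e ME invf_div mulrAC ler_pdivrMr ?ltr_wpDl// ler_pM2l//.
  by rewrite lerDl.
(* The factor 1 + M collects one copy of G and M copies of h^p, each at most eta K^p + C; c2 is the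
   price of returning from K^p to the energy. *)
pose eta := kap / ((1 + M) * c2).
have M1 : 0 < 1 + M by rewrite addr_gt0.
have eta0 : 0 < eta by rewrite divr_gt0// mulr_gt0.
have etac : (1 + M) * (eta * c2) = kap.
  by rewrite /eta; field; rewrite !gt_eqF.
exists eta => // C C0.
(* What remains for x after absorption in 4 kap x <= kap (x + 1) + (1 + M) C V + kap x + 1. *)
pose X1 := (1 + kap + (1 + M) * (C * V)) / (2 * kap).
have X10 : 0 <= X1.
  have CV : 0 <= (1 + M) * (C * V) by rewrite !mulr_ge0// ltW.
  by rewrite divr_ge0 ?addr_ge0 ?mulr_ge0// ltW.
exists (c2 * (X1 + 1)); first by rewrite mulr_ge0 ?addr_ge0// ltW.
move=> v psi A P B s tau N b h K G N0 [hN hc dK dG [K00 G00 K0 G0]] hK GK.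
move=> nv IvV mpsi nA nP nB ms ntau IA IB Nb PAB sAP sPB weak sub sob.
have h0 t : 0 <= h t by have /andP[] := hN t.
have hNp t : h t `^ p <= N `^ p.
  by apply: ler_powR2r; [exact: ltW|exact: h0|have /andP[] := hN t].
have mh : measurable_fun D (fun x => h (psi x)).
  exact: (measurableT_comp (continuous_measurable_fun hc)).
have mK : measurable_fun D (fun x => K (psi x)).
  exact: (measurableT_comp (continuous_measurable_fun (is_derive_continuous dK))).
have mG : measurable_fun D (fun x => G (psi x)).
  exact: (measurableT_comp (continuous_measurable_fun (is_derive_continuous dG))).
have nh : nn_measurable (fun x => h (psi x)) by split.
have nG : nn_measurable (fun x => G (psi x)) by split.
have nhp := nn_powR p mh; have nKp := nn_powR p mK.
have nAp := nn_powR p nA.1; have nBp := nn_powR p nB.1.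
have nPp := nn_powR p nP.1.
have nX := nn_mul nhp nPp.
have PABp x : D x -> P x `^ p <= 2 `^ p * A x `^ p + 2 `^ p * B x `^ p.
  move=> Dx; apply: le_trans (powR_add_le (ltW p0) (nA.2 x Dx) (nB.2 x Dx)).
  by apply: ler_powR2r; [exact: ltW|exact: nP.2|exact: PAB].
have [a IAE] : exists a : R, I (fun x => A x `^ p) = a%:E.
  exists (fine (I (fun x => A x `^ p))).
  by rewrite fineK// ge0_fin_numE// nn_integral_ge0.
have IA' : (I (fun x => A x `^ p) <= a%:E)%E by rewrite IAE.
have p20 : 0 <= 2 `^ p :> R by exact: powR_ge0.
have Np0 : 0 <= N `^ p by exact: powR_ge0.
have IP := nn_integral_le_lin nPp nAp nBp p20 p20 PABp IA' IB.
(* The bound [N] on h is used here only for finiteness, so that x is a real number that can be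
   subtracted from both sides; [N] does not enter X1. *)
have IX : (I (fun x => h (psi x) `^ p * P x `^ p)%R <=
    (N `^ p * (2 `^ p * a + 2 `^ p * b) + 0 * (2 `^ p * a + 2 `^ p * b))%:E)%E.
  apply: (nn_integral_le_lin nX nPp nPp) => // x Dx.
  by rewrite mul0r addr0 ler_wpM2r ?powR_ge0.
have IXfin : (I (fun x => h (psi x) `^ p * P x `^ p)%R < +oo)%E.
  by apply: le_lt_trans IX _; rewrite ltry.
pose x := fine (I (fun x => h (psi x) `^ p * P x `^ p)%R).
have xE : I (fun x => h (psi x) `^ p * P x `^ p)%R = x%:E.
  by rewrite fineK// ge0_fin_numE// nn_integral_ge0.
have x0 : 0 <= x by rewrite fine_ge0// nn_integral_ge0.
(* The Sobolev hypothesis asks for a positive bound on the energy, hence X1 + 1 here and x + 1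
   below. *)
suff xX1 : x <= X1.
  by apply: sob; rewrite ?ltr_wpDl// xE lee_fin (le_trans xX1)// lerDl.
have x10 : 0 < x + 1 by rewrite ltr_wpDl.
have IY : (I (fun x => K (psi x) `^ p * v x)%R <= (c2 * (x + 1))%:E)%E.
  by apply: sob => //; rewrite xE lee_fin lerDl.
have Isub : (I (fun x => (h (psi x) * tau x) `^ p * v x)%R <= (c1 * x)%:E)%E.
  by rewrite EFinM -xE.
have nKv := nn_mul nKp nv.
have nht := nn_mul nh ntau.
have nhtv := nn_mul (nn_powR p nht.1) nv.
have nGt := nn_mul (nn_add nG (nn_mul nhp ntau)) nv.
have nf1 : nn_measurable (fun y => (1 + M) * (eta * K (psi y) `^ p + C) * v y).
  apply: nn_mul => //; apply: nn_mul; first exact/nn_cst/ltW.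
  apply: nn_add; last exact: nn_cst.
  by apply: nn_mul => //; exact/nn_cst/ltW.
have If1 : (I (fun y => (1 + M) * (eta * K (psi y) `^ p + C) * v y)%R <=
    ((1 + M) * eta * (c2 * (x + 1)) + (1 + M) * C * V)%:E)%E.
  apply: (nn_integral_le_lin nf1 nKv nv) => //.
  - by rewrite mulr_ge0// ltW.
  - by rewrite mulr_ge0// ltW.
  - move=> y Dy; rewrite le_eqVlt; apply/orP; left; apply/eqP; ring.
have IW : (I (fun x => (G (psi x) + h (psi x) `^ p * tau x) * v x)%R <=
    (1 * ((1 + M) * eta * (c2 * (x + 1)) + (1 + M) * C * V) + e * (c1 * x))%:E)%E.
  apply: (nn_integral_le_lin nGt nf1 nhtv) => //; first exact: ltW.
  move=> y Dy; rewrite mul1r mulrA -mulrDl; apply: ler_wpM2r; first exact: nv.2.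
  have t0 := ntau.2 y Dy; have hy0 := h0 (psi y).
  have ht : h (psi y) `^ p * tau y <= M * h (psi y) `^ p + e * (h (psi y) * tau y) `^ p.
    have [tM|/ltW Mt] := leP (tau y) M.
      rewrite mulrC (le_trans (ler_wpM2r (powR_ge0 _ _) tM))// lerDl.
      by rewrite mulr_ge0 ?powR_ge0// ltW.
    apply: (@le_trans _ _ (e * (h (psi y) * tau y) `^ p)); last first.
      by rewrite lerDr mulr_ge0 ?powR_ge0// ltW.
    rewrite powRM// mulrCA; apply: ler_wpM2l; first exact: powR_ge0.
    rewrite -(mulr_powRB1 t0 p0) mulrCA ler_peMr//.
    rewrite /e mulrC ler_pdivlMr ?powR_gt0// mul1r.
    by apply: ler_powR2r => //; exact: ltW.
  have := ler_wpM2l (ltW M0) (hK (psi y)); have := GK (psi y).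
  by move: ht; rewrite mulrDl mul1r; lra.
have ms' : measurable_fun D (fun x => h (psi x) `^ p * s x).
  exact: measurable_funM nhp.1 ms.
pose g1 y := N `^ p * (A y `^ p + P y `^ p).
have ng1 : nn_measurable g1 by apply: nn_mul; [exact: nn_cst|exact: nn_add].
have ig1 : mu.-integrable D (EFin \o g1).
  apply: nn_integrable => //.
  apply: (@le_lt_trans _ _ (N `^ p * a + N `^ p * (2 `^ p * a + 2 `^ p * b))%:E).
    apply: (nn_integral_le_lin ng1 nAp nPp Np0 Np0 _ IA' IP) => y Dy.
    by rewrite /g1 mulrDr.
  by rewrite ltry.
have is_ : mu.-integrable D (EFin \o (fun x => h (psi x) `^ p * s x)).
  apply: (le_integrable mD _ _ ig1); first exact/measurable_EFinP.
  move=> y Dy; rewrite /= lee_fin normrM ger0_norm ?powR_ge0//.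
  rewrite (le_trans (ler_pM (powR_ge0 _ _) (normr_ge0 _) (hNp _) (sAP y Dy)))//.
  rewrite (le_trans _ (ler_norm _))// /g1 ler_wpM2l//.
  exact: powRB1_mul_le p1 (nA.2 y Dy) (nP.2 y Dy).
pose g2 y := 2 `^ p * (h (psi y) `^ p * B y `^ p).
have ng2 : nn_measurable g2.
  by apply: nn_mul; [exact: nn_cst|exact: nn_mul].
have Ig2 : (I g2 <= 1%:E)%E.
  apply: (@le_trans _ _ (2 `^ p * N `^ p * b + 0 * b)%:E); last first.
    by rewrite lee_fin mul0r addr0.
  apply: (nn_integral_le_lin ng2 nBp nBp) => //; first by rewrite mulr_ge0.
  move=> y Dy; rewrite /g2 mul0r addr0 mulrA ler_wpM2r ?powR_ge0//.
  by rewrite ler_wpM2l.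
have ig2 : mu.-integrable D (EFin \o g2).
  by apply: nn_integrable => //; apply: le_lt_trans Ig2 _; rewrite ltry.
have iX : mu.-integrable D (EFin \o (fun y => h (psi y) `^ p * P y `^ p)).
  exact: nn_integrable.
(* The pointwise coercivity bound is multiplied by h^p and integrated; the final 1 is the cost of
   replacing gradu by grad psi. *)
have key : (2 `^ (- (p + 1)) * x <=
    1 * ((1 + M) * eta * (c2 * (x + 1)) + (1 + M) * C * V) + e * (c1 * x) + 1).
  rewrite -lee_fin [in leRHS]EFinD.
  apply: le_trans (leeD (le_trans weak IW) Ig2).
  rewrite EFinM -xE -(integralZl mD iX) -(integralD_EFin mD is_ ig2).
  apply: le_integral => //.
  - exact: integrableZl.
  - exact: integrableD.
  move=> y /set_mem Dy; rewrite /= -EFinM -EFinD lee_fin /g2.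
  rewrite mulrCA (mulrCA (2 `^ p)) -mulrDr ler_wpM2l ?powR_ge0//.
  exact: sPB.
rewrite /X1 ler_pdivlMr ?mulr_gt0//.
have k4 : 2 `^ (- (p + 1)) = 4 * kap :> R by rewrite /kap; field.
have ecx : e * (c1 * x) <= kap * x by rewrite mulrA ler_wpM2r.
have etx : (1 + M) * eta * (c2 * (x + 1)) = kap * (x + 1).
  by rewrite -etac; ring.
by rewrite k4 etx in key; lra.
Qed.

End energy.

(** * From inequalities between norms to inequalities between integrals *)

Section norms.
Context (R : realType).
Local Open Scope ereal_scope.

Lemma poweRK (p : R) (x : \bar R) : (0 < p)%R -> 0 <= x ->
  (x `^ p^-1) `^ p = x.
Proof. by move=> p0 x0; rewrite -poweRrM mulVf ?gt_eqF// poweRe1. Qed.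

Lemma ler_poweR2r (p : R) (x y : \bar R) : (0 <= p)%R -> 0 <= x -> x <= y ->
  x `^ p <= y `^ p.
Proof.
move=> p0 x0 xy; apply: gt0_ler_poweR => //; rewrite in_itv /= ?x0 ?leey//=.
by rewrite (le_trans x0).
Qed.

Lemma poweR_inv_le (p c : R) (x y : \bar R) :
  (0 < p)%R -> (0 <= c)%R -> 0 <= x -> 0 <= y ->
  x `^ p^-1 <= c%:E * y `^ p^-1 -> x <= (c `^ p)%:E * y.
Proof.
move=> p0 c0 x0 y0 /(ler_poweR2r (ltW p0) (poweR_ge0 _ _)).
by rewrite poweRM ?poweR_ge0// !poweRK// poweR_EFin.
Qed.

Lemma poweR_inv_cvg0 (p : R) (x : (\bar R)^nat) :
  (0 < p)%R -> (forall j, 0 <= x j) ->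
  x j `^ p^-1 @[j --> \oo] --> 0 ->
  forall e : R, (0 < e)%R -> \forall j \near \oo, x j <= e%:E.
Proof.
move=> p0 x0 xc e e0.
have ep : 0 < (e `^ p^-1)%:E by rewrite lte_fin powR_gt0.
have : \forall j \near \oo, x j `^ p^-1 < (e `^ p^-1)%:E.
  exact: (xc _ (open_nbhs_nbhs (conj (@open_ereal_lt_ereal _ _) ep))).
apply: filterS => j /= /ltW xj.
have := ler_poweR2r (ltW p0) (poweR_ge0 (x j) p^-1) xj.
by rewrite poweRK// poweR_EFin -powRrM mulVf ?gt_eqF// powRr1// ltW.
Qed.

End norms.

Section weighted.
Context (R : realType) (n : nat).
Local Notation point := 'rV[R]_n.+1.
Local Notation vec := 'cV[R]_n.+1.
Context (Omega : set point) (oO : open Omega).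
Local Notation I f :=
  (\int[lebesgue]_(x in (Omega : set (lebRn R n))) (f x)%:E)%E.
Local Notation nn f :=
  (nn_measurable (Omega : set (lebRn R n)) (f : lebRn R n -> R)).

Let mO : measurable (Omega : set (lebRn R n)).
Proof. exact: open_lebesgue_measurable. Qed.

Lemma Lip0_measurable phi : Lip0 Omega phi -> lebesgue_measurable Omega phi.
Proof.
move=> lphi; apply: continuous_lebesgue_measurable => // x _.
exact: lipschitz_at_continuous (Lip0_lipschitz_at x lphi).
Qed.

Lemma dot_measurable (F G : point -> vec) :
  vec_measurable Omega F -> vec_measurable Omega G ->
  lebesgue_measurable Omega (fun x => dot (F x) (G x)).
Proof.
move=> mF mG; apply: measurable_sum => i.
by apply: measurable_funM; [exact: mF|exact: mG].
Qed.

Lemma mulmx_measurable (Q : point -> 'M[R]_n.+1) (G : point -> vec) :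
  mx_measurable Omega Q -> vec_measurable Omega G ->
  vec_measurable Omega (fun x => Q x *m G x).
Proof.
move=> mQ mG i; rewrite /lebesgue_measurable.
under eq_fun do rewrite mxE.
by apply: measurable_sum => j; apply: measurable_funM; [exact: mQ|exact: mG].
Qed.

Lemma sub_measurable (F G : point -> vec) :
  vec_measurable Omega F -> vec_measurable Omega G ->
  vec_measurable Omega (fun x => F x - G x).
Proof.
move=> mF mG i; rewrite /lebesgue_measurable.
under eq_fun do rewrite !mxE.
by apply: measurable_funB; [exact: mF|exact: mG].
Qed.

Section matrix_weight.
Context (Q : point -> 'M[R]_n.+1).
Hypotheses (mQ : mx_measurable Omega Q) (psdQ : forall x, Omega x -> psdmx (Q x)).

Lemma nn_enorm_sqrtmx (G : point -> vec) : vec_measurable Omega G ->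
  nn (fun x => enorm (sqrtmx (Q x) *m G x)).
Proof.
move=> mG; split=> [|x _]; last exact: enorm_ge0.
apply: (@eq_measurable_fun _ _ _ _ _
  (fun x : lebRn R n => Num.sqrt (dot (G x) (Q x *m G x)))).
  by move=> x /set_mem Ox; rewrite enorm_sqrtmx//; exact: psdQ.
apply: (@measurableT_comp _ _ _ _ _ _ (@Num.sqrt R)).
  by apply: continuous_measurable_fun; exact: sqrt_continuous.
by apply: dot_measurable => //; exact: mulmx_measurable.
Qed.

Lemma QLp_norm_lty (p : R) (G : point -> vec) : 0 < p ->
  (QLp_norm p Q Omega G < +oo)%E <->
  (I (fun x => enorm (sqrtmx (Q x) *m G x) `^ p) < +oo)%E.
Proof.
move=> p0; split=> [|/poweR_lty]; last by apply.
by apply: lty_poweRy; rewrite invr_eq0 gt_eqF.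
Qed.

Context (v : point -> R) (wv : weight Omega v).

(** The Luxemburg norm is an infimum, so a strict inequality is needed to extract an admissible l.
    Passing from [SN] to |SN| + 1 with Z > 0 provides it, whatever the sign of [SN]. *)
Lemma sobolev_integral (p SN Z : R) phi : 0 < p ->
  sobolev_no_gain p v Q Omega SN -> Lip0 Omega phi -> 0 < Z ->
  (I (fun x => enorm (sqrtmx (Q x) *m grad phi x) `^ p) <= Z%:E)%E ->
  (I (fun x => `|phi x| `^ p * v x)%R <= ((`|SN| + 1) `^ p * Z)%:E)%E.
Proof.
move=> p0 sob lphi Z0 IZ.
have S0 : 0 < `|SN| + 1 by rewrite ltr_wpDl.
have z0 : 0 < Z `^ p^-1 by rewrite powR_gt0.
have : (Orlicz_norm (fun s : R => s `^ p)%R v Omega phi <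
    ((`|SN| + 1) * Z `^ p^-1)%:E)%E.
  apply: (le_lt_trans (sob _ lphi)).
  apply: (@le_lt_trans _ _ (`|SN| * Z `^ p^-1)%:E); last first.
    by rewrite lte_fin ltr_pM2r// ltrDl.
  rewrite EFinM; apply: (@le_trans _ _ (`|SN|%:E * QLp_norm p Q Omega (grad phi))%E).
    by apply: lee_wpmul2r; [exact: poweR_ge0|rewrite lee_fin ler_norm].
  apply: lee_wpmul2l; first by rewrite lee_fin.
  apply: (ler_poweR2r _ _ IZ); first by rewrite invr_ge0 ltW.
  by apply: integral_ge0 => x _; rewrite lee_fin powR_ge0.
move=> /ereal_inf_lt[_ [l [l0 Il] <-]]; rewrite lte_fin => ll.
have mphi := Lip0_measurable lphi.
have nn1 : nn (fun x => (`|phi x| / l) `^ p * v x).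
  apply: nn_mul; last exact: wv.
  apply: nn_powR; apply: measurable_funM; last exact: measurable_cst.
  exact: (measurableT_comp (@normr_measurable R setT)).
have -> : I (fun x => `|phi x| `^ p * v x)%R =
    ((l `^ p)%:E * I (fun x => (`|phi x| / l) `^ p * v x)%R)%E.
  rewrite -(nn_integralZ lebesgue mO (powR_ge0 _ _) nn1); apply: eq_integral => x _.
  congr EFin; rewrite mulrA -powRM; [|exact: ltW|by rewrite divr_ge0// ltW].
  by rewrite mulrCA divff ?mulr1// gt_eqF.
apply: (@le_trans _ _ ((l `^ p)%:E * 1)%E).
  by apply: lee_wpmul2l => //; rewrite lee_fin powR_ge0.
rewrite mule1 lee_fin.
have -> : Z = (Z `^ p^-1) `^ p by rewrite -powRrM mulVf ?gt_eqF// powRr1// ltW.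
by rewrite -powRM; [apply: ler_powR2r; exact: ltW|exact: ltW|exact: ltW].
Qed.

Lemma subunit_integral (p Ct : R) (t : point -> vec) phi : 0 < p -> 0 <= Ct ->
  subunit p v Q Omega t Ct -> Lip0 Omega phi ->
  (I (fun x => `|dot (t x) (grad phi x)| `^ p * v x)%R <=
   (Ct `^ p)%:E * I (fun x => enorm (sqrtmx (Q x) *m grad phi x) `^ p))%E.
Proof.
move=> p0 C0 sub lphi; apply: poweR_inv_le => //; last exact: sub.
  by apply: integral_ge0 => x Ox; rewrite lee_fin mulr_ge0 ?powR_ge0 ?wv.2.
by apply: integral_ge0 => x _; rewrite lee_fin powR_ge0.
Qed.

End matrix_weight.
End weighted.

(** * Exponential integrability *)

Section exponential_bound.
Context (R : realType) (n : nat).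
Local Notation point := 'rV[R]_n.+1.
Local Notation vec := 'cV[R]_n.+1.
Context (Omega : set point) (oO : open Omega).
Local Notation I f :=
  (\int[lebesgue]_(x in (Omega : set (lebRn R n))) (f x)%:E)%E.
Local Notation nn f :=
  (nn_measurable (Omega : set (lebRn R n)) (f : lebRn R n -> R)).

Let mO : measurable (Omega : set (lebRn R n)).
Proof. exact: open_lebesgue_measurable. Qed.

Context (p : R) (p1 : 1 < p) (v : point -> R) (wv : weight Omega v).
Context (t : point -> vec) (mt : vec_measurable Omega t) (Ct SN : R).

(* The weak inequality after normalization: f and g have been bounded by 1. *)
Definition normalized_subsolution (Q : point -> 'M[R]_n.+1) (gradu : point -> vec) :=
  forall phi, Lip0 Omega phi -> (forall x, 0 <= phi x) ->
    (QLp_norm p Q Omega (grad phi) < +oo)%E ->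
    (dirichlet_lhs p Q Omega gradu phi <=
     I (fun x => (phi x + `|dot (t x) (grad phi x)|) * v x)%R)%E.

Definition Lip0_approx (Q : point -> 'M[R]_n.+1) (u : point -> R)
    (gradu : point -> vec) :=
  forall e : R, 0 < e -> exists psi, [/\ Lip0 Omega psi,
    (I (fun x => `|u x - psi x| `^ p * v x)%R <= e%:E)%E &
    (I (fun x => enorm (sqrtmx (Q x) *m (gradu x - grad psi x)) `^ p)%R <= e%:E)%E].

(** Here the constants are fixed in the right order: eta, then g and C, then X0, all before Q, u and
    L are introduced. The bound N of h depends on L, and psi is taken after N. *)
Lemma truncated_exponential_bound (V : R) : 0 < Ct -> (I v <= V%:E)%E ->
  exists2 g : R, 0 < g & exists2 C : R, 0 <= C &
  forall (Q : point -> 'M[R]_n.+1) (u : point -> R) (gradu : point -> vec) L,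
    mx_measurable Omega Q -> (forall x, Omega x -> psdmx (Q x)) ->
    subunit p v Q Omega t Ct -> sobolev_no_gain p v Q Omega SN ->
    lebesgue_measurable Omega u -> vec_measurable Omega gradu ->
    (I (fun x => enorm (sqrtmx (Q x) *m gradu x) `^ p) < +oo)%E ->
    Lip0_approx Q u gradu -> normalized_subsolution Q gradu ->
    0 <= L -> (I (fun x => expR (g * clip L (u x)) `^ p * v x)%R <= C%:E)%E.
Proof.
move=> Ct0 IvV; have p0 : 0 < p by exact: lt_trans p1.
have nv : nn v by [].
have V0 : 0 <= V.
  by rewrite -lee_fin (le_trans _ IvV)// nn_integral_ge0.
have S0 : 0 < (`|SN| + 1) `^ p by rewrite powR_gt0// ltr_wpDl.
have [eta eta0 energy] := energy_estimate (lebesgue : {measure set (lebRn R n) -> \bar R})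
  mO p1 (powR_ge0 Ct p) S0 V0.
have [g g0 [C C0 triple]] := test_triple_exists p1 eta0.
have [X0 X00 {}energy] := energy C C0.
exists g => //; exists (2 `^ p * X0 + (1 + 4 `^ p * V)).
  by rewrite !addr_ge0 ?mulr_ge0 ?powR_ge0.
move=> Q u gradu L mQ psdQ sub sob mu_ mgu Igu approx weak L0.
have [N [h [K [G [N0 tr hK GK expK]]]]] := triple L L0.
have [hN hc dK dG [K00 G00 K0 G0]] := tr.
have h0 s : 0 <= h s by have /andP[] := hN s.
(* Every error of the approximation is multiplied by at most 2^p N^p, so this precision keeps it
   below 1. *)
pose e := (2 `^ p * N `^ p + 1)^-1.
have NN0 : 0 <= 2 `^ p * N `^ p by rewrite mulr_ge0 ?powR_ge0.
have e0 : 0 < e by rewrite invr_gt0 ltr_wpDl.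
have Ne : 2 `^ p * N `^ p * e <= 1.
  by rewrite /e ler_pdivrMr ?ltr_wpDl// mul1r lerDl.
have [psi [lpsi Iu Ig]] := approx e e0.
have mpsi := Lip0_measurable oO lpsi.
have mgpsi := grad_lebesgue_measurable oO lpsi.
have K_lip := lipschitz_is_derive dK (fun s => _ : `|h s| <= N).
have {}K_lip : forall s s', `|K s - K s'| <= N * `|s - s'|.
  by apply: K_lip => s; rewrite ger0_norm//; have /andP[] := hN s.
have G_lip : forall s s', `|G s - G s'| <= N `^ p * `|s - s'|.
  apply: (lipschitz_is_derive dG) => s; rewrite ger0_norm ?powR_ge0//.
  by apply: ler_powR2r; [exact: ltW|exact: h0|have /andP[] := hN s].
have lK := Lip0_comp lpsi K00 K_lip.
have lG := Lip0_comp lpsi G00 G_lip.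
have gK x : grad (K \o psi) x = h (psi x) *: grad psi x by exact: grad_comp lpsi (dK _).
have gG x : grad (G \o psi) x = h (psi x) `^ p *: grad psi x.
  exact: grad_comp lpsi (dG _).
pose A x := enorm (sqrtmx (Q x) *m gradu x).
pose P x := enorm (sqrtmx (Q x) *m grad psi x).
pose B x := enorm (sqrtmx (Q x) *m (gradu x - grad psi x)).
pose s x := A x `^ (p - 2) * dot (grad psi x) (Q x *m gradu x).
pose tau x := `|dot (t x) (grad psi x)|.
have nA : nn A by exact: nn_enorm_sqrtmx.
have nP : nn P by exact: nn_enorm_sqrtmx.
have nB : nn B by apply: nn_enorm_sqrtmx => //; exact: sub_measurable.
have ms : lebesgue_measurable Omega s.
  apply: measurable_funM; first by apply: measurable_powR_fun; exact: nA.1.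
  by apply: dot_measurable => //; exact: mulmx_measurable.
have ntau : nn tau.
  split=> [|x _]; last exact: normr_ge0.
  apply: (measurableT_comp (@normr_measurable R setT)).
  exact: dot_measurable.
have QK x : enorm (sqrtmx (Q x) *m grad (K \o psi) x) `^ p = h (psi x) `^ p * P x `^ p.
  by rewrite gK -scalemxAr enormZ ger0_norm// powRM ?enorm_ge0.
have tK x : `|dot (t x) (grad (K \o psi) x)| `^ p = (h (psi x) * tau x) `^ p.
  by rewrite gK dotZr normrM ger0_norm.
have PAB x : Omega x -> P x <= A x + B x.
  by move=> Ox; rewrite /P /A /B mulmxBr; exact: enorm_triangle.
have sE x : Omega x -> s x = A x `^ (p - 2) *
    dot (sqrtmx (Q x) *m grad psi x) (sqrtmx (Q x) *m gradu x).
  by move=> Ox; rewrite /s dot_sqrtmx//; exact: psdQ.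
have sAP x : Omega x -> `|s x| <= A x `^ (p - 1) * P x.
  move=> Ox; rewrite sE// normrM ger0_norm ?powR_ge0//.
  rewrite -powRB2_mul ?enorm_ge0// -mulrA ler_wpM2l ?powR_ge0//.
  by rewrite mulrC; exact: cauchy_schwarz.
(* Writing sqrt(Q) grad psi as sqrt(Q) gradu minus the difference, Cauchy-Schwarz gives s >= A^p -
   A^(p-1) B, the quantity that [powR_coercive] bounds from below. *)
have sPB x : Omega x -> 2 `^ (- (p + 1)) * P x `^ p <= s x + 2 `^ p * B x `^ p.
  move=> Ox; apply: le_trans (powR_coercive p1 (enorm_ge0 _) (enorm_ge0 _)
    (enorm_ge0 _) (PAB x Ox)) _.
  rewrite lerD2r sE//.
  rewrite -/(A x) -/(B x) -(mulr_powRB1 (enorm_ge0 _) p0) -(powRB2_mul p1 (enorm_ge0 _)).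
  rewrite mulrCA -mulrA -mulrBr ler_wpM2l ?powR_ge0// enorm_sqr.
  rewrite lerBlDr -lerBlDl -dotBl -mulmxBr mulrC.
  by apply: le_trans (cauchy_schwarz _ _); exact: ler_norm.
have PABp x : Omega x -> P x `^ p <= 2 `^ p * A x `^ p + 2 `^ p * B x `^ p.
  move=> Ox; apply: le_trans (powR_add_le (ltW p0) (enorm_ge0 _) (enorm_ge0 _)).
  by apply: ler_powR2r; [exact: ltW|exact: enorm_ge0|exact: PAB].
have nPp := nn_powR p nP.1.
(* Finite energy of psi comes from P <= A + B; the test function G(psi) then inherits it because G'
   is at most N^p. *)
have IP : (I (fun x => P x `^ p) < +oo)%E.
  apply: (nn_integral_lty_lin mO nPp (nn_powR p nA.1) (nn_powR p nB.1)
    (powR_ge0 _ _) (powR_ge0 _ _) PABp Igu).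
  by apply: le_lt_trans Ig _; rewrite ltry.
have QG : (QLp_norm p Q Omega (grad (G \o psi)) < +oo)%E.
  apply: (QLp_norm_lty Omega Q (grad (G \o psi)) p0).2.
  have nG := nn_powR p (nn_enorm_sqrtmx mQ psdQ (grad_lebesgue_measurable oO lG)).1.
  apply: (nn_integral_lty_lin mO nG nPp nPp (powR_ge0 (N `^ p) p) (lexx 0) _ IP IP).
  move=> x _; rewrite mul0r addr0 gG -scalemxAr enormZ ger0_norm ?powR_ge0//.
  rewrite (powRM p (powR_ge0 _ _) (enorm_ge0 _)); apply: ler_wpM2r.
    exact: powR_ge0.
  apply: ler_powR2r; [exact: ltW|exact: powR_ge0|].
  by apply: ler_powR2r; [exact: ltW|exact: h0|have /andP[] := hN (psi x)].
have eqI_le (f1 f2 : point -> R) : (forall x, f1 x = f2 x) -> (I f1 <= I f2)%E.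
  by move=> /funext ->; exact: lexx.
have IK : (I (fun x => K (psi x) `^ p * v x)%R <= X0%:E)%E.
  apply: (energy v psi A P B s tau N e h K G N0 tr hK GK nv IvV mpsi nA nP nB ms
    ntau Igu Ig Ne PAB sAP sPB).
  - apply: le_trans (le_trans (weak _ lG (fun x => G0 (psi x)) QG) _).
      by apply: eqI_le => x; rewrite gG dotZl mulrCA.
    by apply: eqI_le => x; rewrite gG dotZr normrM (ger0_norm (powR_ge0 _ _)).
  - have E1 : (I (fun x => (h (psi x) * tau x) `^ p * v x)%R <=
        I (fun x => `|dot (t x) (grad (K \o psi) x)| `^ p * v x)%R)%E.
      by apply: eqI_le => x; rewrite tK.
    apply: (le_trans E1 (le_trans (subunit_integral wv p0 (ltW Ct0) sub lK) _)).
    apply: lee_wpmul2l; first by rewrite lee_fin powR_ge0.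
    by apply: eqI_le => x; rewrite QK.
  - move=> Z Z0 IZ.
    apply: le_trans (sobolev_integral oO wv p0 sob lK Z0 (le_trans _ IZ)).
      by apply: eqI_le => x; rewrite (ger0_norm (K0 (psi x))).
    by apply: eqI_le => x; rewrite QK.
have mK w : lebesgue_measurable Omega w -> lebesgue_measurable Omega (fun x => K (w x)).
  exact: (measurableT_comp (continuous_measurable_fun (is_derive_continuous dK))).
have nKv := nn_mul (nn_powR p (mK _ mpsi)) nv.
have mdiff : lebesgue_measurable Omega (fun x => `|u x - psi x|).
  apply: (measurableT_comp (@normr_measurable R setT)).
  exact: measurable_funB.
have nuv := nn_mul (nn_powR p mdiff) nv.
pose f2 x := 2 `^ p * N `^ p * (`|u x - psi x| `^ p * v x) + 4 `^ p * v x.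
have nf2 : nn f2.
  exact: (nn_add (nn_mul (nn_cst _ NN0) nuv) (nn_mul (nn_cst _ (powR_ge0 4 p)) nv)).
have If2 : (I f2 <= (2 `^ p * N `^ p * e + 4 `^ p * V)%:E)%E.
  by apply: (nn_integral_le_lin mO nf2 nuv nv NN0 (powR_ge0 _ _) _ Iu IvV).
have nf : nn (fun x => expR (g * clip L (u x)) `^ p * v x).
  apply: nn_mul; last exact: nv.
  apply: nn_powR.
  have mclip := measurableT_comp (continuous_measurable_fun (@clip_continuous R L)) mu_.
  apply: (measurableT_comp (@measurable_expR R)).
  exact: (measurable_funM (measurable_cst g) mclip).
apply: (@le_trans _ _ (2 `^ p * X0 + 1 * (2 `^ p * N `^ p * e + 4 `^ p * V))%:E).
  apply: (nn_integral_le_lin mO nf nKv nf2 (powR_ge0 _ _) ler01 _ IK If2) => x Ox.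
  rewrite mul1r /f2 !mulrA -!mulrDl; apply: ler_wpM2r; first exact: wv.2.
  apply: le_trans (expK (u x)) _; rewrite addrA lerD2r.
  (* The return from psi to u: K is N-Lipschitz, and N^p times the p-th power of the distance was
     made small by the choice of [e]. *)
  have KuK : K (u x) <= K (psi x) + N * `|u x - psi x|.
    by have := K_lip (u x) (psi x); rewrite ler_norml => /andP[_]; rewrite lerBlDl.
  apply: le_trans (ler_powR2r (ltW p0) (K0 _) KuK) _.
  have Nn : 0 <= N * `|u x - psi x| by rewrite mulr_ge0.
  apply: le_trans (powR_add_le (ltW p0) (K0 _) Nn) _.
  by rewrite powRM// mulrA.
by rewrite mul1r lee_fin lerD2l lerD2r.
Qed.

End exponential_bound.

Section exponential_limit.
Context d (T : measurableType d) (R : realType).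
Context (mu : {measure set T -> \bar R}) (D : set T) (mD : measurable D).
Local Notation I f := (\int[mu]_(x in D) (f x)%:E)%E.

Lemma clip_eq (L s : R) : Num.max s 0 <= L -> clip L s = Num.max s 0.
Proof. by move=> sL; rewrite /clip (min_idPl sL). Qed.

Lemma clip_homo_level (L L' s : R) : L <= L' -> clip L s <= clip L' s.
Proof.
move=> LL; rewrite /clip le_min ge_min lexx /= ge_min.
by rewrite LL orbT.
Qed.

(** Monotone convergence along integer levels; at each point the integrand is constant once the
    level exceeds the positive part of u. *)
Lemma expR_clip_limit (g p C : R) (u v : T -> R) : 0 < g -> 0 <= p ->
  measurable_fun D u -> nn_measurable D v ->
  (forall k : nat, (I (fun x => expR (g * clip k%:R (u x)) `^ p * v x)%R <= C%:E)%E) ->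
  (I (fun x => expR (g * Num.max (u x) 0) `^ p * v x)%R <= C%:E)%E.
Proof.
move=> g0 p0 mu_ nv IC.
pose f (k : nat) x := (expR (g * clip k%:R (u x)) `^ p * v x)%:E.
have nf k : nn_measurable D (fun x => expR (g * clip k%:R (u x)) `^ p * v x).
  apply: nn_mul; last exact: nv.
  apply: nn_powR.
  have mclip := measurableT_comp (continuous_measurable_fun (@clip_continuous R k%:R)) mu_.
  apply: (measurableT_comp (@measurable_expR R)).
  exact: (measurable_funM (measurable_cst g) mclip).
have mf k : measurable_fun D (f k) by apply/measurable_EFinP; exact: (nf k).1.
have f0 k x : D x -> (0 <= f k x)%E by move=> Dx; rewrite lee_fin; exact: (nf k).2.
have fnd x : D x -> {homo f^~ x : n m / (n <= m)%N >-> (n <= m)%E}.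
  move=> Dx n m nm; rewrite lee_fin; apply: ler_wpM2r; first exact: nv.2.
  apply: ge0_ler_powR; rewrite ?nnegrE ?expR_ge0// ler_expR ler_pM2l//.
  by apply: clip_homo_level; rewrite ler_nat.
have flim x : limn (f ^~ x) = (expR (g * Num.max (u x) 0) `^ p * v x)%:E.
  apply/cvg_lim; first exact: ereal_hausdorff.
  apply: cvg_near_cst; near=> k; rewrite /f clip_eq//.
  by near: k; exact: nbhs_infty_ger.
have := @cvg_monotone_convergence _ _ _ mu _ mD _ mf f0 fnd.
rewrite (eq_integral (fun x => (expR (g * Num.max (u x) 0) `^ p * v x)%:E)).
  move=> If; rewrite -(cvg_lim _ If); last exact: ereal_hausdorff.
  apply: lime_le.
    by apply/cvg_ex; eexists; exact: If.
  by apply: nearW => k; exact: IC.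
by move=> x _; rewrite flim.
Unshelve. all: by end_near. Qed.

End exponential_limit.

(** * Comparison of the Orlicz function with an exponential *)

Section orlicz.
Context (R : realType).

(* With x = s / c, the factor x^r is absorbed by exp (q s / 2) and the other
   half of exp (q s) dominates exp x as soon as c >= 2 / q. *)
Lemma powR_expR_le (q r c s : R) : 0 < q -> 0 < r -> 2 / q <= c -> 0 <= s ->
  (s / c) `^ r * expR (s / c) <= (2 * r / q / c) `^ r * expR (q * s).
Proof.
move=> q0 r0 qc s0.
have c0 : 0 < c by apply: lt_le_trans qc; rewrite divr_gt0.
have e1 : s / c <= q * s / 2.
  rewrite ler_pdivrMr//.
  have : s * (2 / q) <= s * c by rewrite ler_wpM2l.
  move/(ler_wpM2l (ltW q0)); rewrite mulrCA.
  rewrite (_ : s * (q * (2 / q)) = s * 2); last by field; rewrite gt_eqF.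
  lra.
have -> : expR (q * s) = expR (q * s / 2) * expR (q * s / 2).
  by rewrite -expRD; congr expR; field.
rewrite mulrA; apply: ler_pM; rewrite ?powR_ge0 ?expR_ge0 ?ler_expR//.
have -> : expR (q * s / 2) = expR (q * s / (2 * r)) `^ r.
  by rewrite -expRM; congr expR; field; rewrite gt_eqF.
have k0 : 0 <= 2 * r / q / c by rewrite !divr_ge0 ?mulr_ge0// ltW.
rewrite -powRM ?expR_ge0//.
apply: ler_powR2r; [exact: ltW|by rewrite divr_ge0// ltW|].
have : q * s / (2 * r) <= expR (q * s / (2 * r)).
  by apply: le_trans (expR_ge1Dx _); rewrite lerDr.
move/(ler_wpM2l k0) => H; apply: le_trans _ H.
by rewrite le_eqVlt; apply/orP; left; apply/eqP; field; rewrite !gt_eqF.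
Qed.

End orlicz.

(** * Normalization of the data, and the return to the Orlicz norm *)

Section normalization.
Context (R : realType) (n : nat).
Local Notation point := 'rV[R]_n.+1.
Local Notation vec := 'cV[R]_n.+1.
Context (Omega : set point) (oO : open Omega).
Local Notation I f :=
  (\int[lebesgue]_(x in (Omega : set (lebRn R n))) (f x)%:E)%E.
Local Notation nn f :=
  (nn_measurable (Omega : set (lebRn R n)) (f : lebRn R n -> R)).

Let mO : measurable (Omega : set (lebRn R n)).
Proof. exact: open_lebesgue_measurable. Qed.

Context (p : R) (p1 : 1 < p) (v : point -> R) (wv : weight Omega v).

Let p0 : 0 < p. Proof. exact: lt_trans p1. Qed.

(** Strictness yields an admissible level below [M]. The set where it is exceeded is null only for v
    dx; as v >= 0 has zero integral there, v vanishes almost everywhere on it, hence the restriction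
    to v != 0. *)
Lemma Linfty_ae_le (f : point -> R) (M : R) : lebesgue_measurable Omega f ->
  (Linfty_norm v Omega f < M%:E)%E ->
  {ae lebesgue, forall x : lebRn R n, Omega x -> v x != 0 -> `|f x| <= M}.
Proof.
move=> mf /ereal_inf_lt[_ [M' [M'0 vM'] <-]]; rewrite lte_fin => M'M.
pose E : set (lebRn R n) := Omega `&` [set x | M' < `|f x|].
have mE : measurable E.
  have mn : measurable_fun (Omega : set (lebRn R n)) (fun x : lebRn R n => `|f x|).
    exact: (measurableT_comp (@normr_measurable R setT)).
  have := mn mO _ (measurable_itv `]M', +oo[).
  by rewrite preimage_itvoy.
have mvE : measurable_fun E (fun x : lebRn R n => (v x)%:E).
  apply/measurable_EFinP; apply: measurable_funS wv.1; first exact: mO.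
  exact: subIsetl.
have : (\int[lebesgue]_(x in E) `|(v x)%:E|)%E = 0%E.
  rewrite -[RHS]vM'; apply: eq_integral => x /set_mem[Ox _].
  by rewrite gee0_abs// lee_fin wv.2.
move/(ae_eq_integral_abs _ mE mvE); apply: filterS => x /= vx Ox v0.
rewrite leNgt; apply/negP => Mf; have := vx (conj Ox (lt_trans M'M Mf)).
by move=> [] /eqP; apply/negP.
Qed.

Context (t : point -> vec) (mt : vec_measurable Omega t).
Context (Q : point -> 'M[R]_n.+1) (mQ : mx_measurable Omega Q)
  (psdQ : forall x, Omega x -> psdmx (Q x)).

(** The absolute value is bounded so that one estimate serves sub- and supersolutions. Points with v
    = 0, where f and g are not controlled, contribute nothing. *)
Lemma dirichlet_rhs_le (f g phi : point -> R) (M : R) : 0 <= M ->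
  lebesgue_measurable Omega f -> lebesgue_measurable Omega g ->
  (Linfty_norm v Omega f < M%:E)%E -> (Linfty_norm v Omega g < M%:E)%E ->
  Lip0 Omega phi -> (forall x, 0 <= phi x) ->
  (`|dirichlet_rhs p v Omega t f g phi| <= (M `^ (p - 1))%:E *
   I (fun x => (phi x + `|dot (t x) (grad phi x)|) * v x)%R)%E.
Proof.
move=> M0 mf mg fM gM lphi phi0.
have mphi := Lip0_measurable oO lphi.
have mdot := dot_measurable mt (grad_lebesgue_measurable oO lphi).
have nabs (w : point -> R) : lebesgue_measurable Omega w -> nn (fun x => `|w x|).
  move=> mw; split=> [|x _]; last exact: normr_ge0.
  exact: (measurableT_comp (@normr_measurable R setT)).
have mpow (w : point -> R) : lebesgue_measurable Omega w ->
    lebesgue_measurable Omega (fun x => `|w x| `^ (p - 2)).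
  by move=> mw; apply: measurable_powR_fun; exact: (nabs _ mw).1.
pose F x := (f x * `|f x| `^ (p - 2) * phi x +
   `|g x| `^ (p - 2) * g x * dot (t x) (grad phi x)) * v x.
have mF : lebesgue_measurable Omega F.
  apply: (measurable_funM _ wv.1); apply: measurable_funD.
    by apply: (measurable_funM (measurable_funM mf (mpow _ mf)) mphi).
  by apply: (measurable_funM (measurable_funM (mpow _ mg) mg) mdot).
have nG : nn (fun x => (phi x + `|dot (t x) (grad phi x)|) * v x).
  apply: nn_mul; last exact: wv.
  by apply: nn_add; [split=> // x _; exact: phi0|exact: nabs].
have nMG := nn_mul (nn_cst (Omega : set (lebRn R n)) (powR_ge0 M (p - 1))) nG.
rewrite -(nn_integralZ lebesgue mO (powR_ge0 _ _) nG).
apply: (le_trans (le_abse_integral lebesgue mO ((measurable_EFinP _ _).2 mF))).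
apply: (ae_ge0_le_integral mO).
- by move=> x _; exact: abse_ge0.
- by apply/measurable_EFinP; exact: (nabs _ mF).1.
- by move=> x Ox; rewrite lee_fin; exact: nMG.2.
- by apply/measurable_EFinP; exact: nMG.1.
apply: filterS2 (Linfty_ae_le mf fM) (Linfty_ae_le mg gM) => x fx gx Ox.
rewrite /= lee_fin /F normrM.
have [v0|v0] := eqVneq (v x) 0; first by rewrite v0 normr0 !mulr0.
rewrite mulrA (ger0_norm (wv.2 x Ox)); apply: ler_wpM2r; first exact: wv.2.
have pow w : `|w| <= M -> `|w| `^ (p - 2) * `|w| <= M `^ (p - 1).
  move=> wM; rewrite powRB2_mul//; apply: ler_powR2r => //.
  by rewrite subr_ge0 ltW.
rewrite mulrDr; apply: (le_trans (ler_normD _ _)); apply: lerD.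
  rewrite !normrM (ger0_norm (powR_ge0 _ _)) (ger0_norm (phi0 x)).
  by apply: ler_wpM2r => //; rewrite mulrC; apply: pow; exact: fx.
rewrite !normrM (ger0_norm (powR_ge0 _ _)); apply: ler_wpM2r => //.
by apply: pow; exact: gx.
Qed.

(** The left side is homogeneous: replacing gradu by c gradu multiplies it by |c|^(p-2) c. With |c|
    = 1/M this cancels exactly the factor M^(p-1) bounding the right side. A negative [c] is the
    case of supersolutions. *)
Lemma normalized_of_weak (gradu : point -> vec) (f g : point -> R) (M c : R) :
  0 < M -> `|c| = M^-1 -> vec_measurable Omega gradu ->
  (QLp_norm p Q Omega gradu < +oo)%E ->
  lebesgue_measurable Omega f -> lebesgue_measurable Omega g ->
  (Linfty_norm v Omega f < M%:E)%E -> (Linfty_norm v Omega g < M%:E)%E ->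
  (forall phi, Lip0 Omega phi -> (forall x, 0 <= phi x) ->
    (c%:E * dirichlet_lhs p Q Omega gradu phi <=
     `|c|%:E * `|dirichlet_rhs p v Omega t f g phi|)%E) ->
  normalized_subsolution Omega p v t Q (fun x => c *: gradu x).
Proof.
move=> M0 cM mgu Igu mf mg fM gM weak phi lphi phi0 Iphi.
have mgphi := grad_lebesgue_measurable oO lphi.
have nA := nn_enorm_sqrtmx mQ psdQ mgu.
have nP := nn_enorm_sqrtmx mQ psdQ mgphi.
pose F x := enorm (sqrtmx (Q x) *m gradu x) `^ (p - 2) *
  dot (grad phi x) (Q x *m gradu x).
have mF : lebesgue_measurable Omega F.
  apply: measurable_funM; first exact: measurable_powR_fun nA.1.
  exact: dot_measurable mgphi (mulmx_measurable mQ mgu).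
have nAp := nn_powR p nA.1; have nPp := nn_powR p nP.1.
have nAP := nn_add nAp nPp.
have iAP : lebesgue.-integrable (Omega : set (lebRn R n)) (EFin \o (fun x : point =>
    enorm (sqrtmx (Q x) *m gradu x) `^ p + enorm (sqrtmx (Q x) *m grad phi x) `^ p)).
  apply: (nn_integrable nAP).
  apply: (nn_integral_lty_lin mO nAP nAp nPp ler01 ler01).
  - by move=> x _; rewrite !mul1r.
  - exact: (QLp_norm_lty Omega Q gradu p0).1.
  - exact: (QLp_norm_lty Omega Q (grad phi) p0).1.
(* Integrability of the signed integrand allows the possibly negative factor [c] to be taken out of
   the integral. *)
have iF : lebesgue.-integrable (Omega : set (lebRn R n)) (EFin \o F).
  apply: (le_integrable mO _ _ iAP); first exact/measurable_EFinP.
  move=> x Ox; rewrite /= lee_fin /F normrM ger0_norm ?powR_ge0//.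
  apply: le_trans (ler_norm _); apply: le_trans (powRB1_mul_le p1 (enorm_ge0 _) (enorm_ge0 _)).
  rewrite -powRB2_mul ?enorm_ge0// -mulrA; apply: ler_wpM2l; first exact: powR_ge0.
  rewrite dot_sqrtmx; last exact: psdQ.
  by rewrite mulrC; exact: cauchy_schwarz.
pose k := M^-1 `^ (p - 2).
have kM : k * `|c| * M `^ (p - 1) = 1.
  rewrite cM /k powRB2_mul ?invr_ge0 ?(ltW M0)// -powRM ?invr_ge0 ?(ltW M0)//.
  by rewrite mulVf ?gt_eqF// powR1.
have lhsE : dirichlet_lhs p Q Omega (fun x => c *: gradu x) phi =
    (k%:E * (c%:E * dirichlet_lhs p Q Omega gradu phi))%E.
  rewrite muleA -EFinM -(integralZl mO iF); apply: eq_integral => x _.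
  rewrite /= -EFinM; congr EFin.
  rewrite -!scalemxAr enormZ dotZr cM powRM ?invr_ge0 ?(ltW M0) ?enorm_ge0// /F /k.
  by ring.
rewrite lhsE; apply: (@le_trans _ _
  (k%:E * (`|c|%:E * `|dirichlet_rhs p v Omega t f g phi|))%E).
  by apply: lee_wpmul2l; [rewrite lee_fin powR_ge0|exact: weak].
apply: (@le_trans _ _ (k%:E * (`|c|%:E * ((M `^ (p - 1))%:E *
   I (fun x => (phi x + `|dot (t x) (grad phi x)|) * v x)%R)))%E).
  apply: lee_wpmul2l; first by rewrite lee_fin powR_ge0.
  apply: lee_wpmul2l; first by rewrite lee_fin normr_ge0.
  exact: dirichlet_rhs_le (ltW M0) mf mg fM gM lphi phi0.
by rewrite !muleA -!EFinM kM mul1e.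
Qed.

Lemma Lip0_approx_scale (u : point -> R) (gradu : point -> vec) (c : R) : c != 0 ->
  QH0 p v Q Omega u gradu ->
  Lip0_approx Omega p v Q (fun x => c * u x) (fun x => c *: gradu x).
Proof.
move=> c0 [[mu_ _] [mgu _] [psi [lpsi upsi gpsi]]] e e0.
have cp0 : 0 < `|c| `^ p by rewrite powR_gt0// normr_gt0.
have e1 : 0 < e / `|c| `^ p by rewrite divr_gt0.
have nD j : nn (fun x => `|u x - psi j x| `^ p * v x).
  apply: nn_mul; last exact: wv.
  apply: nn_powR; apply: (measurableT_comp (@normr_measurable R setT)).
  exact: measurable_funB mu_ (Lip0_measurable oO (lpsi j)).
have nG j : nn (fun x => enorm (sqrtmx (Q x) *m (gradu x - grad (psi j) x)) `^ p).
  apply: nn_powR; apply: (nn_enorm_sqrtmx mQ psdQ _).1.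
  exact: sub_measurable mgu (grad_lebesgue_measurable oO (lpsi j)).
have nearu := poweR_inv_cvg0 p0 (fun j => nn_integral_ge0 lebesgue (nD j)) upsi e1.
have nearg := poweR_inv_cvg0 p0 (fun j => nn_integral_ge0 lebesgue (nG j)) gpsi e1.
have [j [Iu Ig]] : exists j,
    (I (fun x => `|u x - psi j x| `^ p * v x)%R <= (e / `|c| `^ p)%:E)%E /\
    (I (fun x => enorm (sqrtmx (Q x) *m (gradu x - grad (psi j) x)) `^ p)%R
      <= (e / `|c| `^ p)%:E)%E.
  by have [j _ /(_ j (leqnn j)) [? ?]] := filterI nearu nearg; exists j.
have dc (s : R) : is_derive s 1 (fun s : R => c * s) c.
  by have := @is_deriveZ _ _ _ id c s 1 _ (is_derive_id _ _); rewrite scaler1.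
have scaleI (w : point -> R) : nn w ->
    (I w <= (e / `|c| `^ p)%:E)%E -> (I (fun x => `|c| `^ p * w x)%R <= e%:E)%E.
  move=> nw Iw; rewrite (nn_integralZ lebesgue mO (ltW cp0) nw).
  apply: (@le_trans _ _ ((`|c| `^ p)%:E * (e / `|c| `^ p)%:E)%E).
    by apply: lee_wpmul2l; [rewrite lee_fin ltW|exact: Iw].
  by rewrite -EFinM mulrCA divff ?gt_eqF// mulr1 lexx.
exists (fun x => c * psi j x); split.
- apply: (Lip0_comp (G := fun s => c * s) (k := `|c|) (lpsi j)); first exact: mulr0.
  by move=> s s'; rewrite -mulrBr normrM.
- apply: le_trans (scaleI _ (nD j) Iu); rewrite le_eqVlt; apply/orP; left.
  apply/eqP; apply: eq_integral => x _; congr EFin.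
  by rewrite -mulrBr normrM powRM// mulrA.
- apply: le_trans (scaleI _ (nG j) Ig); rewrite le_eqVlt; apply/orP; left.
  apply/eqP; apply: eq_integral => x _; congr EFin.
  rewrite (_ : grad _ x = c *: grad (psi j) x); last exact: grad_comp (lpsi j) (dc _).
  by rewrite -scalerBr -scalemxAr enormZ powRM// enorm_ge0.
Qed.

(** The condition c >= 2/q is what the pointwise comparison with the exponential asks for; the other
    lower bound on c makes its factor (2r/(qc))^r times D at most 1, so c M is admissible in the
    infimum. *)
Lemma Orlicz_norm_le (q r c D M : R) (w : point -> R) :
  0 < q -> 0 < r -> 0 <= D -> 0 < M -> 2 / q <= c -> 2 * r / q * D `^ r^-1 <= c ->
  lebesgue_measurable Omega w ->
  (I (fun x => expR (q * (`|w x| / M)) * v x)%R <= D%:E)%E ->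
  (Orlicz_norm (fun s : R => s `^ r * expR s)%R v Omega w <= (c * M)%:E)%E.
Proof.
move=> q0 r0 D0 M0 qc cD mw ID.
have c0 : 0 < c by apply: lt_le_trans qc; rewrite divr_gt0.
have nw : lebesgue_measurable Omega (fun x => `|w x| / M).
  apply: measurable_funM; last exact: measurable_cst.
  exact: (measurableT_comp (@normr_measurable R setT)).
apply: ereal_inf_lbound; exists (c * M) => //; split; first exact: mulr_gt0.
pose k := (2 * r / q / c) `^ r.
have nE : nn (fun x => expR (q * (`|w x| / M)) * v x).
  apply: nn_mul; last exact: wv.
  split=> [|x _]; last exact: expR_ge0.
  apply: (measurableT_comp (@measurable_expR R)).
  exact: (measurable_funM (measurable_cst q) nw).
have nH : nn (fun x => (`|w x| / (c * M)) `^ r * expR (`|w x| / (c * M)) * v x).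
  have mcM : lebesgue_measurable Omega (fun x => `|w x| / (c * M)).
    apply: measurable_funM; last exact: measurable_cst.
    exact: (measurableT_comp (@normr_measurable R setT)).
  apply: nn_mul; last exact: wv.
  apply: nn_mul; first exact: nn_powR.
  split=> [|x _]; last exact: expR_ge0.
  exact: (measurableT_comp (@measurable_expR R)).
apply: (@le_trans _ _ (k * D + 0 * D)%:E).
  apply: (nn_integral_le_lin mO nH nE nE (powR_ge0 _ _) (lexx 0) _ ID ID) => x Ox.
  rewrite mul0r addr0 mulrA; apply: ler_wpM2r; first exact: wv.2.
  have s0 : 0 <= `|w x| / M by rewrite divr_ge0// ltW.
  have -> : `|w x| / (c * M) = `|w x| / M / c by rewrite invfM mulrA mulrAC.
  exact: powR_expR_le.
rewrite mul0r addr0 lee_fin /k.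
have -> : D = (D `^ r^-1) `^ r by rewrite -powRrM mulVf ?gt_eqF// powRr1.
have K0 : 0 <= 2 * r / q by rewrite divr_ge0 ?mulr_ge0// ltW.
have K1 : 0 <= 2 * r / q / c by rewrite divr_ge0// ltW.
rewrite -(powRM r K1 (powR_ge0 _ _)) [leRHS](_ : _ = 1 `^ r); last by rewrite powR1.
apply: ler_powR2r; [exact: ltW|exact: mulr_ge0 K1 (powR_ge0 _ _)|].
by rewrite mulrAC ler_pdivrMr// mul1r.
Qed.

End normalization.

(** * Uniform exponential integrability, for both signs of u *)

Section exponential_integrability.
Context (R : realType) (n : nat).
Local Notation point := 'rV[R]_n.+1.
Local Notation vec := 'cV[R]_n.+1.
Context (Omega : set point) (oO : open Omega).
Local Notation I f :=
  (\int[lebesgue]_(x in (Omega : set (lebRn R n))) (f x)%:E)%E.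

(** The sign [a] is 1 for subsolutions and -1 for supersolutions. The exponent is q = g p because
    the truncated estimate controls the p-th power of exp(g s). *)
Lemma exponential_integrability (p : R) (v : point -> R) (t : point -> vec)
    (Ct SN : R) :
  1 < p -> weight Omega v -> L1 Omega v -> vec_measurable Omega t -> 0 < Ct ->
  exists2 q : R, 0 < q & exists2 D : R, 0 <= D &
  forall Q, mx_measurable Omega Q -> (forall x, Omega x -> psdmx (Q x)) ->
    subunit p v Q Omega t Ct -> sobolev_no_gain p v Q Omega SN ->
  forall (f g : point -> R) (M a : R), 0 < M -> `|a| = 1 ->
    lebesgue_measurable Omega f -> lebesgue_measurable Omega g ->
    (Linfty_norm v Omega f < M%:E)%E -> (Linfty_norm v Omega g < M%:E)%E ->
  forall u gradu, QH0 p v Q Omega u gradu ->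
    (forall phi, Lip0 Omega phi -> (forall x, 0 <= phi x) ->
      (a%:E * dirichlet_lhs p Q Omega gradu phi <=
       `|dirichlet_rhs p v Omega t f g phi|)%E) ->
    (I (fun x => expR (q * (Num.max (a * u x) 0 / M)) * v x)%R <= D%:E)%E.
Proof.
move=> p1 wv L1v mt Ct0; have p0 : 0 < p by exact: lt_trans p1.
have mO : measurable (Omega : set (lebRn R n)) by exact: open_lebesgue_measurable.
have [V IvV] : exists V : R, (I v <= V%:E)%E.
  exists (fine (I v)).
  by rewrite (fineK (integrable_fin_num mO L1v)); exact: lexx.
have [g g0 [D D0 trunc]] := truncated_exponential_bound oO p1 wv mt SN Ct0 IvV.
exists (g * p); first exact: mulr_gt0.
exists D => // Q mQ psdQ sub sob f0 g1 M a M0 a1 mf mg fM gM u gradu uQ weak.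
have [[mu_ _] [mgu Igu] _] := uQ.
pose c := a / M.
have a0 : a != 0 by rewrite -normr_gt0 a1.
have c0 : c != 0 by rewrite mulf_neq0// invr_eq0 gt_eqF.
have cM : `|c| = M^-1 by rewrite normrM a1 mul1r gtr0_norm ?invr_gt0.
have normalized : normalized_subsolution Omega p v t Q (fun x => c *: gradu x).
  apply: (normalized_of_weak oO p1 wv mt mQ psdQ M0 cM mgu Igu mf mg fM gM).
  move=> phi lphi phi0; rewrite cM /c mulrC EFinM -muleA.
  apply: lee_wpmul2l; first by rewrite lee_fin invr_ge0 ltW.
  exact: weak.
have approx := Lip0_approx_scale oO p1 wv mQ psdQ c0 uQ.
have mcu : lebesgue_measurable Omega (fun x => c * u x).
  exact: (measurable_funM (measurable_cst c) mu_).
have mcgu : vec_measurable Omega (fun x => c *: gradu x).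
  move=> i; rewrite /lebesgue_measurable; under eq_fun do rewrite mxE.
  exact: (measurable_funM (measurable_cst c) (mgu i)).
have Icgu : (I (fun x => enorm (sqrtmx (Q x) *m (c *: gradu x)) `^ p) < +oo)%E.
  have nA := nn_enorm_sqrtmx mQ psdQ mgu; have nAp := nn_powR p nA.1.
  have ncA := nn_powR p (nn_enorm_sqrtmx mQ psdQ mcgu).1.
  have Iu := (QLp_norm_lty Omega Q gradu p0).1 Igu.
  apply: (nn_integral_lty_lin mO ncA nAp nAp (powR_ge0 `|c| p) (lexx 0) _ Iu Iu).
  move=> x _; rewrite mul0r addr0 -scalemxAr enormZ.
  by rewrite (powRM p (normr_ge0 c) (enorm_ge0 _)).
have := expR_clip_limit mO g0 (ltW p0) mcu wv (fun k => trunc Q _ _ k%:R mQ psdQ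
  sub sob mcu mcgu Icgu approx normalized (ler0n R k)).
apply: le_trans; rewrite le_eqVlt; apply/orP; left; apply/eqP.
apply: eq_integral => x _; congr EFin; congr (_ * _).
rewrite -expRM; congr expR.
rewrite maxr_pMl ?invr_ge0 ?(ltW M0)// mul0r /c (mulrAC a).
by rewrite -mulrA (mulrC p) mulrA.
Qed.

Lemma Linfty_norm_ge0 (v f : point -> R) : (0 <= Linfty_norm v Omega f)%E.
Proof. by apply: le_ereal_inf_tmp => _ [M [M0 _] <-]; rewrite lee_fin. Qed.

End exponential_integrability.

Theorem theorem1p6 (R : realType) (n : nat) (Omega : set 'rV[R]_n.+1)
    (p : R) (v : 'rV[R]_n.+1 -> R) (t : 'rV[R]_n.+1 -> 'cV[R]_n.+1)
    (Ct SN r : R) :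
  let H := fun s : R => s `^ r * expR s in
  bounded_domain Omega -> 1 < p ->
  weight Omega v -> L1 Omega v ->
  vec_measurable Omega t -> 0 < Ct -> 0 < r ->
  exists2 C : R, 0 < C &
  forall (Q : 'rV[R]_n.+1 -> 'M[R]_n.+1) (k : R),
    mx_measurable Omega Q ->
    (forall x, Omega x -> psdmx (Q x)) ->
    {ae lebesgue, forall x : lebRn R n,
      Omega x -> opnorm (Q x) `^ (p / 2) <= k * v x} ->
    subunit p v Q Omega t Ct ->
    sobolev_no_gain p v Q Omega SN ->
  forall f g : 'rV[R]_n.+1 -> R, Linfty v Omega f -> Linfty v Omega g ->
  let bound := (C%:E * (Linfty_norm v Omega f + Linfty_norm v Omega g))%E in
  forall (u : 'rV[R]_n.+1 -> R) (gradu : 'rV[R]_n.+1 -> 'cV[R]_n.+1),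
  [/\ weak_subsolution p v Q Omega t f g u gradu ->
        (Orlicz_norm H v Omega (u^\+)%R <= bound)%E,
      weak_supersolution p v Q Omega t f g u gradu ->
        (Orlicz_norm H v Omega (u^\-)%R <= bound)%E &
      weak_solution p v Q Omega t f g u gradu ->
        Orlicz H v Omega u /\ (Orlicz_norm H v Omega u <= bound)%E].
Proof.
move=> H [oO _ _ _] p1 wv L1v mt Ct0 r0.
have mO : measurable (Omega : set (lebRn R n)) by exact: open_lebesgue_measurable.
have [q q0 [D D0 expI]] := exponential_integrability oO SN p1 wv L1v mt Ct0.
(* Twice [D], because for solutions exp(q |u| / M) is estimated by the sum of the exponentials of
   the two one-sided parts. *)
have D20 : 0 <= D + D by rewrite addr_ge0.
pose c := Num.max (2 / q) (2 * r / q * (D + D) `^ r^-1).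
have qc : 2 / q <= c by rewrite le_max lexx.
have Dc : 2 * r / q * (D + D) `^ r^-1 <= c by rewrite le_max lexx orbT.
have c0 : 0 < c by apply: lt_le_trans qc; rewrite divr_gt0.
exists c => // Q k mQ psdQ _ sub sob f g [mf fL] [mg gL] bound u gradu.
(* The estimate holds for [M] strictly above both norms. Taking their sum plus e / c and letting e
   tend to 0 gives the bound; the slack also keeps [M] positive when both norms are 0. *)
have boundP (w : 'rV[R]_n.+1 -> R) : (forall M : R, 0 < M ->
    (Linfty_norm v Omega f < M%:E)%E -> (Linfty_norm v Omega g < M%:E)%E ->
    (Orlicz_norm H v Omega w <= (c * M)%:E)%E) -> (Orlicz_norm H v Omega w <= bound)%E.
  have := Linfty_norm_ge0 Omega v f; have := Linfty_norm_ge0 Omega v g.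
  rewrite /bound; move: fL gL.
  case: (Linfty_norm v Omega f) (Linfty_norm v Omega g) => [F||] [G||] // _ _.
  rewrite !lee_fin => G0 F0 wM; apply/lee_addgt0Pr => e e0.
  have ec : 0 < e / c by rewrite divr_gt0.
  apply: (le_trans (wM (F + G + e / c) _ _ _)); rewrite ?lte_fin.
  - by rewrite ltr_wpDl// addr_ge0.
  - by rewrite -addrA ltrDl ltr_wpDl.
  - by rewrite addrAC ltrDr ltr_wpDl.
  by rewrite -(EFinD F G) -(EFinM c) -EFinD lee_fin mulrDr mulrCA divff ?mulr1// gt_eqF.
have mu_ : QH0 p v Q Omega u gradu -> lebesgue_measurable Omega u.
  by move=> [[mu_ _] _ _].
have mmax (a : R) : QH0 p v Q Omega u gradu ->
    lebesgue_measurable Omega (fun x => Num.max (a * u x) 0).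
  move=> uQ; have mau := measurable_funM (measurable_cst a) (mu_ uQ).
  have m0 : measurable_fun (Omega : set (lebRn R n)) (fun=> 0 : R).
    exact: measurable_cst.
  exact: (@measurable_maxr _ (lebRn R n) R Omega (fun x => a * u x) (fun=> 0) mau m0).
pose e (a M : R) (x : 'rV[R]_n.+1) := expR (q * (Num.max (a * u x) 0 / M)) * v x.
have ne a M : QH0 p v Q Omega u gradu ->
    nn_measurable (Omega : set (lebRn R n)) (e a M : lebRn R n -> R).
  move=> uQ; apply: nn_mul; last exact: wv.
  split=> [|x _]; last exact: expR_ge0.
  apply: (measurableT_comp (@measurable_expR R)).
  apply: (measurable_funM (measurable_cst q)).
  apply: (measurable_funM _ (measurable_cst M^-1)).
  exact: mmax.
have expI' := expI Q mQ psdQ sub sob f g.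
have exp_le (a : R) : `|a| = 1 -> QH0 p v Q Omega u gradu ->
    (forall phi, Lip0 Omega phi -> (forall x, 0 <= phi x) ->
      (a%:E * dirichlet_lhs p Q Omega gradu phi <=
       `|dirichlet_rhs p v Omega t f g phi|)%E) ->
    forall M : R, 0 < M ->
    (Linfty_norm v Omega f < M%:E)%E -> (Linfty_norm v Omega g < M%:E)%E ->
    (\int[lebesgue]_(x in (Omega : set (lebRn R n))) (e a M x)%:E <= D%:E)%E.
  move=> a1 uQ weak M M0 fM gM.
  exact: (expI Q mQ psdQ sub sob f g M a M0 a1 mf mg fM gM u gradu uQ weak).
have one_sided (a : R) (w : 'rV[R]_n.+1 -> R) : `|a| = 1 ->
    (forall x, w x = Num.max (a * u x) 0) -> QH0 p v Q Omega u gradu ->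
    (forall phi, Lip0 Omega phi -> (forall x, 0 <= phi x) ->
      (a%:E * dirichlet_lhs p Q Omega gradu phi <=
       `|dirichlet_rhs p v Omega t f g phi|)%E) ->
    (Orlicz_norm H v Omega w <= bound)%E.
  move=> a1 wE uQ weak; apply: boundP => M M0 fM gM.
  apply: (Orlicz_norm_le oO wv q0 r0 D20 M0 qc Dc).
    rewrite (_ : w = fun x => Num.max (a * u x) 0); last exact/funext.
    exact: mmax.
  apply: (@le_trans _ _ D%:E); last by rewrite lee_fin lerDl.
  apply: le_trans (exp_le a a1 uQ weak M M0 fM gM).
  rewrite le_eqVlt; apply/orP; left; apply/eqP; apply: eq_integral => x _.
  by rewrite wE ger0_norm// le_max lexx orbT.
have subE : weak_subsolution p v Q Omega t f g u gradu ->
    forall phi, Lip0 Omega phi -> (forall x, 0 <= phi x) ->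
    (1%:E * dirichlet_lhs p Q Omega gradu phi <=
     `|dirichlet_rhs p v Omega t f g phi|)%E.
  move=> [_ weak] phi lphi phi0; rewrite mul1e.
  exact: le_trans (weak phi lphi phi0) (lee_abs _).
have superE : weak_supersolution p v Q Omega t f g u gradu ->
    forall phi, Lip0 Omega phi -> (forall x, 0 <= phi x) ->
    ((-1)%:E * dirichlet_lhs p Q Omega gradu phi <=
     `|dirichlet_rhs p v Omega t f g phi|)%E.
  move=> [_ weak] phi lphi phi0; rewrite EFinN mulN1e -abseN.
  by apply: le_trans (lee_abs _); rewrite leeN2; exact: weak.
split.
- move=> sol; apply: (one_sided 1) (subE sol); first exact: normr1.
    by move=> x; rewrite mul1r.
  exact: sol.1.
- move=> sol; apply: (one_sided (-1)) (superE sol); first by rewrite normrN1.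
    by move=> x; rewrite mulN1r.
  exact: sol.1.
move=> [uQ weak].
have sub_u : weak_subsolution p v Q Omega t f g u gradu.
  by split=> // phi lphi _; rewrite weak.
have super_u : weak_supersolution p v Q Omega t f g u gradu.
  by split=> // phi lphi _; rewrite weak.
have ubound : (Orlicz_norm H v Omega u <= bound)%E.
  apply: boundP => M M0 fM gM.
  apply: (Orlicz_norm_le oO wv q0 r0 D20 M0 qc Dc (mu_ uQ)).
  have nu : nn_measurable (Omega : set (lebRn R n))
      (fun x : lebRn R n => expR (q * (`|u x| / M)) * v x).
    apply: nn_mul; last exact: wv.
    split=> [|x _]; last exact: expR_ge0.
    apply: (measurableT_comp (@measurable_expR R)).
    apply: (measurable_funM (measurable_cst q)).
    apply: (measurable_funM _ (measurable_cst M^-1)).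
    exact: (measurableT_comp (@normr_measurable R setT) (mu_ uQ)).
  apply: (@le_trans _ _ (1 * D + 1 * D)%:E); last by rewrite mul1r.
  apply: (nn_integral_le_lin mO nu (ne 1 M uQ) (ne (-1) M uQ) ler01 ler01).
  (* At each point one of the two summands is exp(q |u| / M) and the other is positive. *)
  - move=> x Ox; rewrite !mul1r -mulrDl; apply: ler_wpM2r; first exact: wv.2.
    have [u0|/ltW u0] := leP 0 (u x).
      by rewrite ger0_norm// mul1r (max_idPl u0) lerDl expR_ge0.
    rewrite ler0_norm// mulN1r [in X in _ + X](max_idPl _) ?oppr_ge0//.
    by rewrite lerDr expR_ge0.
  - exact: exp_le (normr1 R) uQ (subE sub_u) M M0 fM gM.
  - exact: exp_le (normrN1 R) uQ (superE super_u) M M0 fM gM.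
split=> //; split; first exact: mu_.
apply: le_lt_trans ubound _; rewrite /bound.
have := Linfty_norm_ge0 Omega v f; have := Linfty_norm_ge0 Omega v g.
move: fL gL.
case: (Linfty_norm v Omega f) (Linfty_norm v Omega g) => [F||] [G||] // _ _ _ _.
by rewrite -EFinD -EFinM ltry.
Qed.
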